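(* If $P$ is a nonempty pattern, then there are integers $n_1,\ldots,n_r\ge1$, $k_1,\ldots,k_r\ge0$ and vectors $v_1,\ldots,v_r\in\mathbb{Z}^2$ such that $P\in\gamma\left(\bigcup_{i=1}^r (v_i+P_{n_i,k_i})\right)$, the patterns $v_i+P_{n_i,k_i}$ pairwise do not touch, $\sum_{i=1}^r n_i=|P|-e(P)$ and $\sum_{i=1}^r k_i=e(P)$.
   Context: A pattern is a finite subset $P\subset\mathbb{Z}^2$. Let $T=\{(0,1),(1,1),(1,0)\}$ and $T_n=\{(a,b)\in\{0,\ldots,n-1\}^2 : a+b\geq n-1\}$. A solitaire move applies to $P$ at $v$ when $|P\cap(v+T)|=2$ and replaces $P$ by $(P\setminus(v+T))\cup S$ for an arbitrary two-element $S\subset v+T$; $\gamma(P)$ is the set of patterns reachable by finitely many moves. The filling $\varphi(P)$ is obtained by repeatedly adding a point $w$ whenever there is $v$ with $|P\cap(v+T)|=2$ (current set) and $w\in v+T$, until stable. Let $N(x)=\{x\pm(1,0),x\pm(0,1),x\pm(1,-1)\}$ and $N(A)=\bigcup_{x\in A}N(x)$. The filling decomposes uniquely (up to order) as $\varphi(P)=\bigcup_{i=1}^r(v_i+T_{k_i})$ with $N(v_i+T_{k_i})\cap(v_j+T_{k_j})=\varnothing$ for $i\ne j$; the excess is $e(P)=|P|-\sum_i k_i$. Two patterns $A,B$ touch if $\varphi(A)\cap N(\varphi(B))\ne\varnothing$ or $\varphi(B)\cap N(\varphi(A))\neq\varnothing$. For $0\le k\le n(n-1)/2$, the pattern $P_{n,k}$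 consists of the top row $\{(a,n-1):0\le a\le n-1\}$ of $T_n$ together with the first $k$ points of $T_n\setminus\{(a,n-1)\}$ in the order listing rows from top to bottom (decreasing second coordinate) and, within each row, from right to left (decreasing first coordinate). *)

(* Defs.v *)
From mathcomp Require Import all_boot all_order all_algebra finmap zify boolp.
From Stdlib Require Export Relation_Operators.

Set Implicit Arguments.
Unset Strict Implicit.
Unset Printing Implicit Defensive.

Import Order.TTheory GRing.Theory Num.Theory.
Local Open Scope fset_scope.
Local Open Scope ring_scope.

Notation point := (int * int)%type.
Definition pattern : Type := {fset point}.

Definition translate (v : point) (A : pattern) : pattern :=
  [fset v + x | x in A].

Definition cellT : pattern := [fset (0, 1); (1, 1); (1, 0)].

Definition triangle (n : nat) : pattern :=
  [fset x in [seq (a%:Z, b%:Z) | a <- iota 0 n, b <- iota 0 n]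
     | n%:Z - 1 <= x.1 + x.2].

Definition solitaire_move (P Q : pattern) : Prop :=
  exists (v : point) (S : pattern),
    [/\ #|` P `&` translate v cellT| = 2%N,
        S `<=` translate v cellT,
        #|` S| = 2%N
      & Q = (P `\` translate v cellT) `|` S].

(* gamma P Q means that Q belongs to the orbit of P. *)
Definition gamma (P Q : pattern) : Prop :=
  clos_refl_trans pattern solitaire_move P Q.

Definition fill_step (P Q : pattern) : Prop :=
  exists (v w : point),
    [/\ #|` P `&` translate v cellT| = 2%N,
        w \in translate v cellT
      & Q = w |` P].

Definition fill_stable (P : pattern) : Prop :=
  forall Q, fill_step P Q -> Q = P.

Definition is_filling (P F : pattern) : Prop :=
  clos_refl_trans pattern fill_step P F /\ fill_stable F.

Definition neighbours (x : point) : pattern :=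
  [fset x + (1, 0); x - (1, 0); x + (0, 1); x - (0, 1);
        x + (1, -1); x - (1, -1)].

Definition neighbourhood (A : pattern) : pattern :=
  \bigcup_(x <- A) neighbours x.

(* An element (v, k) of D stands for the triangle v + T_k.  Using a set of   *)
(* such pairs, all with k >= 1, makes the decomposition a genuine one: since *)
(* x is not in N(x), a one-point triangle repeated twice would satisfy the   *)
(* separation condition, and empty triangles could be added freely.          *)
Definition is_triangle_decomposition
    (F : pattern) (D : {fset point * nat}) : Prop :=
  [/\ forall t, t \in D -> (0 < t.2)%N,
      F = \bigcup_(t <- D) translate t.1 (triangle t.2)
    & forall t u, t \in D -> u \in D -> t != u ->
        neighbourhood (translate t.1 (triangle t.2))
          `&` translate u.1 (triangle u.2) = fset0].

Lemma in_translate v A x : (x \in translate v A) = (x - v \in A).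
Proof.
apply/imfsetP/idP => [[y /= yA ->]|xA]; first by rewrite addrC addKr.
by exists (x - v) => //=; rewrite addrC subrK.
Qed.

Lemma in_cell v x : (x \in translate v cellT) =
  [|| x == (v.1, v.2 + 1), x == (v.1 + 1, v.2 + 1) | x == (v.1 + 1, v.2)].
Proof.
by rewrite in_translate /cellT !inE; case: x v => a b [c d] /=;
   rewrite !xpair_eqE /= /GRing.add /=; lia.
Qed.

Lemma in_triangle v n x : (x \in translate v (triangle n)) =
  [&& x.1 - v.1 < n%:Z, x.2 - v.2 < n%:Z
    & n%:Z - 1 <= (x.1 - v.1) + (x.2 - v.2)].
Proof.
rewrite in_translate /triangle !inE; case: x v => a b [c d] /=.
apply/andP/and3P => [[/allpairsP[[i j]]] /=|[h1 h2 h3]].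
  rewrite !mem_iota => -[hi hj [-> ->]] h; split; lia.
split; last lia.
apply/allpairsP; exists (`|a - c|%N, `|b - d|%N); rewrite !mem_iota /=.
by split; [lia|lia|congr pair => /=; lia].
Qed.

Lemma in_neighbours x y : (y \in neighbours x) =
  ((y.1 - x.1, y.2 - x.2) \in
    [:: (1, 0); (-1, 0); (0, 1); (0, -1); (1, -1); (-1, 1)]).
Proof.
rewrite /neighbours !inE; case: x y => a b [c d] /=.
rewrite !xpair_eqE /=.
lia.
Qed.

Lemma neighbourhoodP A y :
  reflect (exists2 x, x \in A & y \in neighbours x) (y \in neighbourhood A).
Proof.
apply: (iffP (bigfcupP _ _ _ _)) => [[x /andP[xA _] yx]|[x xA yx]].
  by exists x.
by exists x => //; rewrite xA.
Qed.

Lemma card_cell v : #|` translate v cellT| = 3%N.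
Proof.
rewrite card_in_imfset //=; first by rewrite /cellT fsetUC cardfsU1 cardfs2 !inE.
by move=> x y _ _ /addrI.
Qed.

Lemma stable_cell F v x y z : fill_stable F ->
  x \in translate v cellT -> y \in translate v cellT ->
  z \in translate v cellT -> x != y -> x \in F -> y \in F -> z \in F.
Proof.
move=> sF xv yv zv xy xF yF.
have h2 : (1 < #|` F `&` translate v cellT|)%N.
  have -> : 2%N = #|` [fset x; y]| by rewrite cardfs2 xy.
  apply: fsubset_leq_card; apply/fsubsetP => w; rewrite !inE.
  by case/orP => /eqP->; rewrite ?xF ?yF ?xv ?yv.
case: (eqVneq #|` F `&` translate v cellT| 2%N) => [e|ne].
  by rewrite -(sF (z |` F)) ?fset1U1 //; exists v, z.
have : F `&` translate v cellT = translate v cellT.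
  apply/eqP; rewrite eqEfcard fsubsetIr /= card_cell.
  by rewrite ltn_neqAle eq_sym ne.
by move/fsetP/(_ z); rewrite in_fsetI zv andbT.
Qed.

Lemma card2_elems (A : pattern) : #|` A| = 2%N ->
  exists x y, [/\ x != y, x \in A & y \in A].
Proof.
move=> c2; have /fset0Pn[x xA] : A != fset0 by rewrite -cardfs_gt0 c2.
have /fset0Pn[y] : A `\ x != fset0.
  by move: c2; rewrite (cardfsD1 x) xA -cardfs_gt0; lia.
by rewrite !inE => /andP[yx yA]; exists x, y; rewrite eq_sym.
Qed.

Lemma fill_sub_stable P Q F : fill_stable F -> P `<=` F ->
  clos_refl_trans pattern fill_step P Q -> Q `<=` F.
Proof.
move=> sF PF PQ; elim: PQ PF => {P Q} [P Q [v [w [c2 wv ->]]] PF||] //; last first.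
  by move=> P Q R _ h1 _ h2 /h1/h2.
rewrite fsubUset PF andbT fsub1set.
have [x [y [xy xP yP]]] := card2_elems c2.
move: xP yP; rewrite !(in_fsetI P) => /andP[xP xv] /andP[yP yv].
by apply: (stable_cell sF xv yv wv xy); apply: (fsubsetP PF).
Qed.

Lemma fill_sub P Q : clos_refl_trans pattern fill_step P Q -> P `<=` Q.
Proof.
elim=> {P Q} [P Q [v [w [_ _ ->]]]|P|P Q R _ h1 _ h2].
- exact: fsubsetU1.
- exact: fsubset_refl.
- exact: fsubset_trans h1 h2.
Qed.

Lemma is_filling_uniq P F G : is_filling P F -> is_filling P G -> F = G.
Proof.
move=> [PF sF] [PG sG]; apply/eqP; rewrite eqEfsubset.
by rewrite (fill_sub_stable sG (fill_sub PG) PF)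
           (fill_sub_stable sF (fill_sub PF) PG).
Qed.

Lemma triangle_stable v n : fill_stable (translate v (triangle n)).
Proof.
move=> Q [u [w [c2 wu ->]]]; apply/fsetUidPr; rewrite fsub1set.
set A := translate v _ in c2 *.
have [x [y [xy xP yP]]] := card2_elems c2.
move: xP yP wu xy; rewrite /A !in_fsetI !in_triangle !in_cell.
case: x y w u v {c2 A Q} => [x1 x2] [y1 y2] [w1 w2] [u1 u2] [v1 v2] /=.
rewrite !xpair_eqE; lia.
Qed.

Lemma in_some_triangle (P : pattern) :
  exists v n, P `<=` translate v (triangle n).
Proof.
suff [v [n h]] : exists v n, {subset (P : seq _) <= translate v (triangle n)}.
  by exists v, n; apply/fsubsetP => x; apply: h.
elim: (P : seq point) => [|[a b] s [[c d] [n IH]]]; first by exists 0, 0%N.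
have [m hm] : exists m : nat, `|a| + `|b| + `|c| + `|d| + n%:Z < m%:Z.
  by exists (`|a| + `|b| + `|c| + `|d| + n).+1%N; lia.
exists (c - 2 * m%:Z, d - 2 * m%:Z), (n + 3 * m)%N => -[y z].
by rewrite inE => /orP[/eqP[-> ->]|/IH]; rewrite !in_triangle /=; lia.
Qed.

Lemma filling_exists P : exists F, is_filling P F.
Proof.
have [v [n]] := in_some_triangle P; set A := translate _ _ => PA.
have [m] := ubnP (#|` A| - #|` P|)%N; elim: m => // m IH in P PA *.
rewrite ltnS => le_m.
have [sP|/existsNP[Q /not_implyP[PQ QP]]] := pselect (fill_stable P).
  by exists P; split=> //; apply: rt_refl.
have PQ' : P `<=` Q by apply/fill_sub/rt_step.
have QA : Q `<=` A by apply: fill_sub_stable PA (rt_step _ _ _ _ PQ);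
  apply: triangle_stable.
have ltPQ : (#|` P| < #|` Q|)%N.
  apply: fproper_ltn_card; rewrite fproperEneq PQ' andbT.
  by apply/eqP => e; apply: QP.
have leQA := fsubset_leq_card QA.
have [|F [QF sF]] := IH Q QA; first lia.
by exists F; split=> //; apply: rt_trans QF; apply: rt_step.
Qed.

Definition filling (P : pattern) : pattern := sval (cid (filling_exists P)).

Lemma fillingP P : is_filling P (filling P).
Proof. exact: svalP (cid (filling_exists P)). Qed.

Section Triangles.

Let tri (t : point * nat) : pattern := translate t.1 (triangle t.2).

Let in_tri v n (a b : int) : ((a, b) \in tri (v, n)) =
  [&& a - v.1 < n%:Z, b - v.2 < n%:Z & n%:Z - 1 <= (a - v.1) + (b - v.2)].
Proof. exact: in_triangle. Qed.

Let tri_inj t u : (0 < t.2)%N -> (0 < u.2)%N -> tri t = tri u -> t = u.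
Proof.
case: t u => [[a b] n] [[c d] m] /= n0 m0 /fsetP e.
have := e (a + n%:Z - 1, b + n%:Z - 1).
have := e (c + m%:Z - 1, d + m%:Z - 1).
have := e (a, b + n%:Z - 1).
have := e (c, d + m%:Z - 1).
have := e (a + n%:Z - 1, b).
have := e (c + m%:Z - 1, d).
rewrite !in_tri /= => h1 h2 h3 h4 h5 h6.
have [ea eb en] : [/\ a = c, b = d & n = m] by split; lia.
by rewrite ea eb en.
Qed.

Let tri_connected t (X : pattern) x0 : x0 \in tri t -> x0 \in X ->
  (forall x y, x \in X -> x \in tri t -> y \in neighbours x -> y \in tri t ->
    y \in X) -> tri t `<=` X.
Proof.
case: t => [[c d] n] x0t x0X step.
have n0 : (0 < n)%N by move: x0t; case: x0 {x0X} => a b; rewrite in_tri /=; lia.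
have hstep (a b a' b' : int) : (a, b) \in X -> (a, b) \in tri ((c, d), n) ->
    (a', b') \in tri ((c, d), n) ->
    (a' - a, b' - b) \in [:: (1, 0); (-1, 0); (0, 1); (0, -1) : point] ->
    (a', b') \in X.
  move=> h1 h2 h3 h4; apply: (step (a, b)) => //.
  by rewrite in_neighbours /=; move: h4; rewrite !inE !xpair_eqE; lia.
have ax : (c + n%:Z - 1, d + n%:Z - 1) \in X.
  have right i (a b : int) : (a, b) \in X -> (a, b) \in tri ((c, d), n) ->
      (a + i%:Z, b) \in tri ((c, d), n) -> (a + i%:Z, b) \in X.
    elim: i a => [|i IH] a abX abt; first by rewrite addr0.
    move=> h; have -> : a + i.+1%:Z = (a + 1) + i%:Z by lia.
    have t1 : (a + 1, b) \in tri ((c, d), n) by move: abt h; rewrite !in_tri /=; lia.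
    apply: IH => //.
    - by apply: (hstep a b) => //; rewrite !inE !xpair_eqE; lia.
    - by move: h; rewrite !in_tri /=; lia.
  have up i (a b : int) : (a, b) \in X -> (a, b) \in tri ((c, d), n) ->
      (a, b + i%:Z) \in tri ((c, d), n) -> (a, b + i%:Z) \in X.
    elim: i b => [|i IH] b abX abt; first by rewrite addr0.
    move=> h; have -> : b + i.+1%:Z = (b + 1) + i%:Z by lia.
    have t1 : (a, b + 1) \in tri ((c, d), n) by move: abt h; rewrite !in_tri /=; lia.
    apply: IH => //.
    - by apply: (hstep a b) => //; rewrite !inE !xpair_eqE; lia.
    - by move: h; rewrite !in_tri /=; lia.
  case: x0 x0t x0X => a b x0t x0X.
  have h1 : (c + n%:Z - 1, b) \in X.
    have -> : c + n%:Z - 1 = a + (absz (c + n%:Z - 1 - a)%R)%:Z.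
      by move: x0t; rewrite in_tri /=; lia.
    by apply: right => //; move: x0t; rewrite !in_tri /=; lia.
  have -> : d + n%:Z - 1 = b + (absz (d + n%:Z - 1 - b)%R)%:Z.
    by move: x0t; rewrite in_tri /=; lia.
  by apply: up => //; move: x0t; rewrite !in_tri /=; lia.
have left i : (i < n)%N -> (c + n%:Z - 1 - i%:Z, d + n%:Z - 1) \in X.
  elim: i => [|i IH] lti; first by rewrite subr0.
  apply: (hstep _ _ _ _ (IH (ltnW lti))).
  - by rewrite in_tri /=; lia.
  - by rewrite in_tri /=; lia.
  - by rewrite !inE !xpair_eqE; lia.
have down i j : (i + j < n)%N ->
    (c + n%:Z - 1 - i%:Z, d + n%:Z - 1 - j%:Z) \in X.
  elim: j => [|j IH] lti; first by rewrite subr0 left //; lia.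
  have lti' : (i + j < n)%N by lia.
  apply: (hstep _ _ _ _ (IH lti')).
  - by rewrite in_tri /=; lia.
  - by rewrite in_tri /=; lia.
  - by rewrite !inE !xpair_eqE; lia.
apply/fsubsetP => -[a b]; rewrite in_tri /= => h.
have := down (absz (c + n%:Z - 1 - a)%R) (absz (d + n%:Z - 1 - b)%R).
have -> : c + n%:Z - 1 - (absz (c + n%:Z - 1 - a)%R)%:Z = a by lia.
have -> : d + n%:Z - 1 - (absz (d + n%:Z - 1 - b)%R)%:Z = b by lia.
by apply; lia.
Qed.

Let decomposition_sub F D D' t u x :
  is_triangle_decomposition F D -> is_triangle_decomposition F D' ->
  t \in D -> u \in D' -> x \in tri t -> x \in tri u -> tri t `<=` tri u.
Proof.
move=> [_ eF _] [_ eF' sep] tD uD xt xu.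
apply: (tri_connected xt xu) => y z yu yt zy zt.
have : z \in F by rewrite eF; apply/bigfcupP; exists t; rewrite ?tD.
rewrite eF' => /bigfcupP[u' /andP[u'D _] zu'].
have [<-//|ne] := eqVneq u' u.
have : z \in neighbourhood (tri u) `&` tri u'.
  by rewrite in_fsetI zu' andbT; apply/neighbourhoodP; exists y.
by rewrite sep // eq_sym.
Qed.

Let apex_in (t : point * nat) : (0 < t.2)%N ->
  (t.1.1 + t.2%:Z - 1, t.1.2 + t.2%:Z - 1) \in tri t.
Proof. by case: t => [[a b] n] /=; rewrite in_tri /=; lia. Qed.

Lemma triangle_decomposition_uniq F D D' :
  is_triangle_decomposition F D -> is_triangle_decomposition F D' -> D = D'.
Proof.
suff sub E E' : is_triangle_decomposition F E ->
    is_triangle_decomposition F E' -> E `<=` E'.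
  by move=> h h'; apply/eqP; rewrite eqEfsubset !sub.
move=> dE dE'; apply/fsubsetP => t tE.
have [posE eF _] := dE; have [posE' eF' _] := dE'.
have xt := apex_in (posE _ tE); set x := (_, _) in xt.
have : x \in F by rewrite eF; apply/bigfcupP; exists t; rewrite ?tE.
rewrite eF' => /bigfcupP[u /andP[uE' _] xu].
suff -> : t = u by [].
apply: (tri_inj (posE _ tE) (posE' _ uE')); apply/eqP; rewrite eqEfsubset.
by rewrite (decomposition_sub dE dE' tE uE' xt xu)
           (decomposition_sub dE' dE uE' tE xu xt).
Qed.

Let tri_grow F t x : fill_stable F -> (0 < t.2)%N -> tri t `<=` F ->
  x \in neighbourhood (tri t) -> x \in F -> x \notin tri t ->
  exists u, [/\ u.2 = t.2.+1, tri t `<=` tri u & tri u `<=` F].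
Proof.
move=> sF; case: t => [[c d] n] /= n0 tF /neighbourhoodP[[a b] abt].
have inF (a' b' : int) : (a', b') \in tri ((c, d), n) -> (a', b') \in F.
  exact: (fsubsetP tF).
have cell v p q r : p \in F -> q \in F -> p != q ->
    p \in translate v cellT -> q \in translate v cellT ->
    r \in translate v cellT -> r \in F.
  by move=> pF qF pq pv qv rv; apply: (stable_cell sF pv qv rv pq).
case: x => x y; rewrite in_neighbours /= => nb xyF xyt.
move: abt xyt nb; rewrite !in_tri /= !inE !xpair_eqE => abt xyt nb.
have [hA|[hB|hC]] : x - c = n%:Z \/ y - d = n%:Z \/
    (x - c) + (y - d) = n%:Z - 2 by lia.
-
  exists ((c, d - 1), n.+1); split=> //.
    by apply/fsubsetP => -[p q]; rewrite !in_tri /=; lia.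
  have up i : y + i%:Z - d < n%:Z -> (x, y + i%:Z) \in F.
    elim: i => [|i IH] hi; first by rewrite addr0.
    apply: (cell (x - 1, y + i%:Z) (x, y + i%:Z) (x - 1, y + i%:Z + 1)).
    + by apply: IH; lia.
    + by apply: inF; rewrite in_tri /=; lia.
    + by rewrite xpair_eqE; lia.
    + by rewrite in_cell /= !xpair_eqE; lia.
    + by rewrite in_cell /= !xpair_eqE; lia.
    + by rewrite in_cell /= !xpair_eqE; lia.
  have down i : - 1 <= y - i%:Z - d -> (x, y - i%:Z) \in F.
    elim: i => [|i IH] hi; first by rewrite subr0.
    apply: (cell (x - 1, y - i%:Z - 1) (x, y - i%:Z) (x - 1, y - i%:Z)).
    + by apply: IH; lia.
    + by apply: inF; rewrite in_tri /=; lia.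
    + by rewrite xpair_eqE; lia.
    + by rewrite in_cell /= !xpair_eqE; lia.
    + by rewrite in_cell /= !xpair_eqE; lia.
    + by rewrite in_cell /= !xpair_eqE; lia.
  apply/fsubsetP => -[p q]; rewrite in_tri /= => h.
  have [pq|npq] := boolP ((p, q) \in tri ((c, d), n)); first exact: inF.
  have -> : p = x by move: npq; rewrite in_tri /=; lia.
  have [le|lt] := lerP y q.
    have -> : q = y + (absz (q - y)%R)%:Z by lia.
    by apply: up; lia.
  have -> : q = y - (absz (y - q)%R)%:Z by lia.
  by apply: down; lia.
-
  exists ((c - 1, d), n.+1); split=> //.
    by apply/fsubsetP => -[p q]; rewrite !in_tri /=; lia.
  have up i : x + i%:Z - c < n%:Z -> (x + i%:Z, y) \in F.
    elim: i => [|i IH] hi; first by rewrite addr0.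
    apply: (cell (x + i%:Z, y - 1) (x + i%:Z, y) (x + i%:Z + 1, y - 1)).
    + by apply: IH; lia.
    + by apply: inF; rewrite in_tri /=; lia.
    + by rewrite xpair_eqE; lia.
    + by rewrite in_cell /= !xpair_eqE; lia.
    + by rewrite in_cell /= !xpair_eqE; lia.
    + by rewrite in_cell /= !xpair_eqE; lia.
  have down i : - 1 <= x - i%:Z - c -> (x - i%:Z, y) \in F.
    elim: i => [|i IH] hi; first by rewrite subr0.
    apply: (cell (x - i%:Z - 1, y - 1) (x - i%:Z, y) (x - i%:Z, y - 1)).
    + by apply: IH; lia.
    + by apply: inF; rewrite in_tri /=; lia.
    + by rewrite xpair_eqE; lia.
    + by rewrite in_cell /= !xpair_eqE; lia.
    + by rewrite in_cell /= !xpair_eqE; lia.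
    + by rewrite in_cell /= !xpair_eqE; lia.
  apply/fsubsetP => -[p q]; rewrite in_tri /= => h.
  have [pq|npq] := boolP ((p, q) \in tri ((c, d), n)); first exact: inF.
  have -> : q = y by move: npq; rewrite in_tri /=; lia.
  have [le|lt] := lerP x p.
    have -> : p = x + (absz (p - x)%R)%:Z by lia.
    by apply: up; lia.
  have -> : p = x - (absz (x - p)%R)%:Z by lia.
  by apply: down; lia.
-
  exists ((c - 1, d - 1), n.+1); split=> //.
    by apply/fsubsetP => -[p q]; rewrite !in_tri /=; lia.
  have up i : x + i%:Z - c < n%:Z -> (x + i%:Z, y - i%:Z) \in F.
    elim: i => [|i IH] hi; first by rewrite addr0 subr0.
    apply: (cell (x + i%:Z, y - i%:Z - 1) (x + i%:Z, y - i%:Z)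
                 (x + i%:Z + 1, y - i%:Z)).
    + by apply: IH; lia.
    + by apply: inF; rewrite in_tri /=; lia.
    + by rewrite xpair_eqE; lia.
    + by rewrite in_cell /= !xpair_eqE; lia.
    + by rewrite in_cell /= !xpair_eqE; lia.
    + by rewrite in_cell /= !xpair_eqE; lia.
  have down i : y + i%:Z - d < n%:Z -> (x - i%:Z, y + i%:Z) \in F.
    elim: i => [|i IH] hi; first by rewrite subr0 addr0.
    apply: (cell (x - i%:Z - 1, y + i%:Z) (x - i%:Z, y + i%:Z)
                 (x - i%:Z, y + i%:Z + 1)).
    + by apply: IH; lia.
    + by apply: inF; rewrite in_tri /=; lia.
    + by rewrite xpair_eqE; lia.
    + by rewrite in_cell /= !xpair_eqE; lia.
    + by rewrite in_cell /= !xpair_eqE; lia.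
    + by rewrite in_cell /= !xpair_eqE; lia.
  apply/fsubsetP => -[p q]; rewrite in_tri /= => h.
  have [pq|npq] := boolP ((p, q) \in tri ((c, d), n)); first exact: inF.
  have epq : p + q = x + y by move: npq; rewrite in_tri /=; lia.
  have [le|lt] := lerP x p.
    have -> : p = x + (absz (p - x)%R)%:Z by lia.
    have -> : q = y - (absz (p - x)%R)%:Z by lia.
    by apply: up; lia.
  have -> : p = x - (absz (x - p)%R)%:Z by lia.
  have -> : q = y + (absz (x - p)%R)%:Z by lia.
  by apply: down; lia.
Qed.

Let size_tri t : (t.2 <= #|` tri t|)%N.
Proof.
case: t => [[c d] n] /=.
pose f (i : 'I_n) : point := (c + i%:Z, d + n%:Z - 1).
have f_inj : injective f by move=> i j [h]; apply: val_inj => /=; lia.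
have {1}<- : size [seq f i | i <- enum 'I_n] = n by rewrite size_map size_enum_ord.
apply: uniq_leq_size => [|y /mapP[i _ ->]]; first by rewrite map_inj_uniq ?enum_uniq.
by rewrite /f in_tri /=; have := ltn_ord i; lia.
Qed.

Lemma triangle_decomposition_exists F :
  fill_stable F -> exists D, is_triangle_decomposition F D.
Proof.
move=> sF.
pose C : {fset point * nat} := [fset t in
  [seq ((x.1 - n%:Z + 1, x.2 - n%:Z + 1), n) | x <- F, n <- iota 1 #|` F|]
  | tri t `<=` F].
have inC t : (t \in C) = (0 < t.2)%N && (tri t `<=` F).
  rewrite /C !inE /=; have [tF|] := boolP (tri t `<=` F); last by rewrite !andbF.
  rewrite !andbT; apply/allpairsP/idP => [[[x n] /= [_]]|t0].
    by rewrite mem_iota => /andP[n0 _] ->.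
  exists ((t.1.1 + t.2%:Z - 1, t.1.2 + t.2%:Z - 1), t.2) => /=; split.
  - exact: (fsubsetP tF _ (apex_in t0)).
  - by rewrite mem_iota add1n ltnS t0 (leq_trans (size_tri t)) ?fsubset_leq_card.
  - by case: t {tF t0} => [[a b] n] /=; congr ((_, _), _); lia.
clearbody C.
pose D := [fset t in C | all (fun u => (tri t `<=` tri u) ==> (u == t)) C].
have inD t : t \in D -> [/\ (0 < t.2)%N, tri t `<=` F &
    forall u, (0 < u.2)%N -> tri u `<=` F -> tri t `<=` tri u -> u = t].
  rewrite /D !inE inC => /andP[/andP[t0 tF] /allP h]; split=> // u u0 uF tu.
  by apply/eqP; move: (h u); rewrite inC u0 uF tu; apply.
have maxD t : t \in C -> exists2 u, u \in D & tri t `<=` tri u.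
  have [m] := ubnP (#|` F| - #|` tri t|)%N; elim: m => // m IH in t *.
  rewrite ltnS => le_m tC.
  have [tD|] := boolP (t \in D); first by exists t.
  rewrite !inE tC /= => /allPn[u uC]; rewrite negb_imply => /andP[tu ut].
  have [|//|w wD uw] := IH u; last by exists w => //; apply: fsubset_trans uw.
  move: tC uC; rewrite !inC => /andP[t0 tF] /andP[u0 uF].
  have : (#|` tri t| < #|` tri u|)%N.
    apply: fproper_ltn_card; rewrite fproperEneq tu andbT.
    by apply: contra ut => /eqP/(tri_inj t0 u0) ->.
  by have := fsubset_leq_card uF; lia.
have closedD t x : t \in D -> x \in neighbourhood (tri t) -> x \in F ->
    x \in tri t.
  move=> /inD[t0 tF tmax] xt xF; apply/negPn/negP => nxt.
  have [u [u2 tu uF]] := tri_grow sF t0 tF xt xF nxt.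
  by have := tmax u; rewrite u2 => /(_ isT uF tu) e; move: u2; rewrite e; lia.
exists D; split=> [t /inD[]//||t u tD uD ne].
  apply/fsetP => x; apply/idP/bigfcupP => [xF|[t /andP[/inD[_ tF _] _]]]; last first.
    exact: (fsubsetP tF).
  have xx y : (y \in tri (x, 1%N)) = (y == x).
    by case: x y {xF} => a b [a' b']; rewrite in_tri xpair_eqE /=; lia.
  have [|t tD xt] := maxD (x, 1%N).
    by rewrite inC /=; apply/fsubsetP => y; rewrite xx => /eqP->.
  by exists t; rewrite ?tD //; apply: (fsubsetP xt); rewrite xx.
apply/fsetP => x; rewrite in_fsetI [RHS]in_fset0; apply/negP => /andP[xt xu].
have [t0 tF tmax] := inD _ tD; have [u0 uF umax] := inD _ uD.
have xt' := closedD _ _ tD xt (fsubsetP uF _ xu).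
have ut : tri u `<=` tri t.
  apply: (tri_connected xu xt') => y z yt yu zy zu.
  apply: (closedD t) => //; last exact: (fsubsetP uF).
  by apply/neighbourhoodP; exists y.
by case/eqP: ne; apply: umax.
Qed.

End Triangles.

Lemma filling_triangles_exist P :
  exists D, is_triangle_decomposition (filling P) D.
Proof. exact: triangle_decomposition_exists (fillingP P).2. Qed.

Definition filling_triangles (P : pattern) : {fset point * nat} :=
  sval (cid (filling_triangles_exist P)).

Lemma filling_trianglesP P :
  is_triangle_decomposition (filling P) (filling_triangles P).
Proof. exact: svalP (cid (filling_triangles_exist P)). Qed.

Definition excess (P : pattern) : int :=
  #|` P|%:Z - \sum_(t <- filling_triangles P) t.2%:Z.

Definition touch (A B : pattern) : Prop :=
  filling A `&` neighbourhood (filling B) <> fset0 \/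
  filling B `&` neighbourhood (filling A) <> fset0.

(* T_n without its top row: rows from top to bottom, each from right to left. *)
Definition lower_rows (n : nat) : seq point :=
  [seq x <- [seq (a%:Z, b%:Z) | b <- rev (iota 0 n.-1), a <- rev (iota 0 n)]
     | x \in triangle n].

(* Meaningful for k <= n (n - 1) / 2; larger values of k are truncated.       *)
Definition Ppattern (n k : nat) : pattern :=
  [fset (a%:Z, n%:Z - 1) | a in iota 0 n] `|` [fset x in take k (lower_rows n)].

(* Main.v *)
(* A point lying outside a moving pair either is untouched or completes the    *)
(* cell, in which case the move only relabels points (gamma_carry); hence any  *)
(* orbit relation survives the addition of spectators, up to displacing them.  *)
(* The top row of T_n can be moved to each of the three sides, and absorbs an  *)
(* adjacent point into the top row of some T_{n+1}; moreover all patterns of a *)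
(* given size between the top row and T_n lie in one orbit.                    *)
(*   Given P, move it to a disjoint union of C and R, with C between a top row *)
(* and its triangle and |C| maximal.  By absorption no pattern in the orbit of *)
(* R meets the triangle or its neighbourhood.  Every point of the filling of R *)
(* is occupied by some pattern in the orbit of R, so R and C do not touch, and *)
(* induction on |R| concludes.                                                 *)

Require Import Defs.
From mathcomp Require Import all_boot all_order all_algebra finmap.
From mathcomp Require Import zify boolp.

Set Implicit Arguments.
Unset Strict Implicit.
Unset Printing Implicit Defensive.

Import Order.TTheory GRing.Theory Num.Theory.
Local Open Scope fset_scope.
Local Open Scope ring_scope.

(** The pattern is taken apart by splitting off a largest core, a set [C] lying between the top row
    of some v + T_n with n >= 1 and that whole triangle. Consider all splittings of patterns in the
    orbit of [P] into a core [C] and a rest [R], and take |C| maximal. A point of [R] inside the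
    triangle could be counted in [C], and a point next to it could be absorbed into a larger core
    ([line_grow]); so [R] stays away from the triangle ([max_core_far]). Moves of [R] then never
    meet [C], so this holds along the whole orbit of [R] ([max_core_gamma]). By induction on size,
    [R] lies in the orbit of a union of separated translates of P_{n,k}, and every point of its
    filling is occupied by some pattern of that orbit ([separated_reach]). Hence the whole filling
    of [R] is away from the triangle, which is exactly non-touching ([separated_exists]).

    The core can be replaced by v + P_{n,k} with k = |C| - n, because patterns of equal size between
    top row and triangle share an orbit ([triangle_connect]). This goes by induction on n, splitting
    T_{n+1} into its top row and a copy of T_n: surplus points below are pumped up until the top row
    is full or the lower part is only its own top row ([top_normal]).

    Parts are handled independently by [gamma_lift] (extra points off the filling do not interfere)
    and [gamma_carry] (other extra points may get displaced). Finally, size and filling are orbit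
    invariants, so uniqueness of the decomposition identifies the constructed triangles with those
    of the filling of [P], and counting points gives both sums. *)

Ltac bool_cases := repeat match goal with
  | |- context [@eq_op ?T ?a ?b] => case: (@eq_op T a b)
  | |- context [@in_mem ?T ?a ?b] => case: (@in_mem T a b)
  end; try (by []); rewrite /is_true; intuition congruence.

Notation tri v n := (translate v%R (triangle n%N)).

(** * Cells, moves and the orbit relation *)

(** Naming the three points, in any order, lets a move be described by the point that stays, the one
    that leaves and the one that enters. *)
Definition is_cell (x y z : point) : Prop :=
  exists v, translate v cellT = [fset x; y; z] /\ [/\ x != y, y != z & x != z].

Lemma is_cellI v x y z : x \in translate v cellT -> y \in translate v cellT ->
  z \in translate v cellT -> x != y -> y != z -> x != z -> is_cell x y z.
Proof.
move=> xv yv zv xy yz xz; exists v; split=> //.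
apply/esym/eqP; rewrite eqEfcard card_cell; apply/andP; split.
  by apply/fsubsetP => w; rewrite !inE -orbA => /or3P[]/eqP->.
rewrite fsetUC cardfsU1 cardfs2 xy !inE negb_or.
by rewrite ![z == _]eq_sym xz yz.
Qed.

Lemma is_cellC x y z : is_cell x y z -> is_cell y x z.
Proof.
move=> [v [e [xy yz xz]]]; exists v; rewrite e; split.
  by apply/fsetP => w; rewrite !inE; bool_cases.
by split=> //; rewrite eq_sym.
Qed.

Lemma is_cellCr x y z : is_cell x y z -> is_cell x z y.
Proof.
move=> [v [e [xy yz xz]]]; exists v; rewrite e; split.
  by apply/fsetP => w; rewrite !inE; bool_cases.
by split=> //; rewrite eq_sym.
Qed.

Lemma gamma_refl P : gamma P P.
Proof. exact: rt_refl. Qed.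

Lemma gamma_trans Q P R : gamma P Q -> gamma Q R -> gamma P R.
Proof. exact: rt_trans. Qed.

Lemma move_sym P Q : solitaire_move P Q -> solitaire_move Q P.
Proof.
move=> [v [S [c2 Sv S2 ->]]]; exists v, (P `&` translate v cellT).
have -> : (P `\` translate v cellT `|` S) `&` translate v cellT = S.
  apply/fsetP => x; rewrite !(in_fsetI, in_fsetD, in_fsetU).
  by have := fsubsetP Sv x; bool_cases.
split=> //; first exact: fsubsetIr.
apply/fsetP => x; rewrite !(in_fsetI, in_fsetD, in_fsetU).
by have := fsubsetP Sv x; bool_cases.
Qed.

Lemma gamma_sym P Q : gamma P Q -> gamma Q P.
Proof.
elim=> [A B /move_sym|A|A B C _ h1 _ h2]; first exact: rt_step.
  exact: rt_refl.
exact: rt_trans h2 h1.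
Qed.

Lemma gamma_move P x y z : is_cell x y z -> x \in P -> y \in P -> z \notin P ->
  gamma P (z |` (P `\ y)).
Proof.
move=> [v [e [xy yz xz]]] xP yP zP; apply: rt_step; exists v, [fset x; z].
have [yx zy zx] : [/\ y != x, z != y & z != x] by split; rewrite eq_sym.
split; rewrite ?e ?cardfs2 ?xz //.
- have -> : P `&` [fset x; y; z] = [fset x; y]; last by rewrite cardfs2 xy.
  apply/fsetP => w; rewrite !(in_fsetI, inE).
  have [->|nx] := eqVneq w x; first by rewrite xP.
  have [->|ny] := eqVneq w y; first by rewrite yP.
  by have [->|nz] := eqVneq w z; rewrite ?andbF ?(negbTE zP).
- by apply/fsubsetP => w; rewrite !inE => /orP[]/eqP->; rewrite eqxx ?orbT.
- apply/fsetP => w; rewrite !(in_fsetI, in_fsetD, inE) !negb_or.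
  have [->|nx] := eqVneq w x; first by rewrite xP xy orbT.
  have [->|ny] := eqVneq w y; first by rewrite /= (negbTE yz).
  by have [->|nz] := eqVneq w z; rewrite ?orbT //= ?orbF.
Qed.

Lemma move_card P Q : solitaire_move P Q -> #|` Q| = #|` P|.
Proof.
move=> [v [S [c2 Sv S2 ->]]]; rewrite cardfsU S2.
have -> : (P `\` translate v cellT) `&` S = fset0.
  apply/fsetP => x; rewrite !(in_fsetI, in_fsetD) in_fset0.
  by have := fsubsetP Sv x; case: (x \in S) => [->//|]; rewrite andbF.
by rewrite cardfs0 subn0 -c2 addnC cardfsID.
Qed.

Lemma gamma_card P Q : gamma P Q -> #|` Q| = #|` P|.
Proof. by elim=> [A B /move_card|A|A B C _ h1 _ h2] //; rewrite h2. Qed.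

(** * Fillings are invariant under moves *)

Lemma fill_stableI F :
  (forall v x y z, x \in translate v cellT -> y \in translate v cellT ->
     z \in translate v cellT -> x != y -> x \in F -> y \in F -> z \in F) ->
  fill_stable F.
Proof.
move=> h Q [v [w [c2 wv ->]]]; apply/fsetUidPr; rewrite fsub1set.
have [x [y [xy]]] := card2_elems c2; rewrite !(in_fsetI F).
by move=> /andP[xF xv] /andP[yF yv]; apply: (h v x y).
Qed.

Lemma sub_filling P : P `<=` filling P.
Proof. exact: fill_sub (fillingP P).1. Qed.

Lemma filling_stable P : fill_stable (filling P).
Proof. exact: (fillingP P).2. Qed.

Lemma filling_min P F : fill_stable F -> P `<=` F -> filling P `<=` F.
Proof. by move=> sF PF; apply: (fill_sub_stable sF PF); case: (fillingP P). Qed.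

Lemma filling_mono P Q : P `<=` Q -> filling P `<=` filling Q.
Proof.
move=> PQ; apply: filling_min; first exact: filling_stable.
exact: fsubset_trans PQ (sub_filling Q).
Qed.

Lemma two_in_filling P v : #|` P `&` translate v cellT| = 2%N ->
  translate v cellT `<=` filling P.
Proof.
move=> c2; have [x [y [xy]]] := card2_elems c2; rewrite !(in_fsetI P).
move=> /andP[xP xv] /andP[yP yv]; apply/fsubsetP => z zv.
apply: (stable_cell (@filling_stable P) xv yv zv xy);
  exact: (fsubsetP (sub_filling P)).
Qed.

(** A cell that can move lies inside the filling, so a move cannot leave it; reversibility of moves
    gives the other inclusion. *)
Lemma move_filling P Q : solitaire_move P Q -> filling Q = filling P.
Proof.
have sub A B : solitaire_move A B -> filling B `<=` filling A.
  move=> [v [S [c2 Sv S2 ->]]]; apply: filling_min; first exact: filling_stable.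
  have cA := two_in_filling c2; apply/fsubsetP => x.
  rewrite in_fsetU in_fsetD => /orP[/andP[_ xA]|xS].
    exact: (fsubsetP (sub_filling A)).
  exact: (fsubsetP cA _ (fsubsetP Sv _ xS)).
by move=> m; apply/eqP; rewrite eqEfsubset (sub _ _ m) (sub _ _ (move_sym m)).
Qed.

Lemma gamma_filling P Q : gamma P Q -> filling Q = filling P.
Proof. by elim=> [A B /move_filling|A|A B C _ h1 _ h2] //; rewrite h2. Qed.

(** * Moving a pattern in the presence of other points *)

Lemma fdisjointP_in (A B : pattern) :
  reflect (forall x, x \in A -> x \in B -> False) [disjoint A & B]%fset.
Proof.
apply: (iffP idP) => [/fdisjointP h x xA xB|h].
  by move: (h x xA); rewrite xB.
by apply/fdisjointP => x xA; apply/negP => /(h x xA).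
Qed.

Lemma move_add v (S P Z : pattern) : [disjoint Z & translate v cellT]%fset ->
  #|` P `&` translate v cellT| = 2%N -> S `<=` translate v cellT ->
  #|` S| = 2%N ->
  solitaire_move (P `|` Z) ((P `\` translate v cellT `|` S) `|` Z).
Proof.
move=> /fdisjointP_in dZ c2 Sv S2; exists v, S; split=> //.
  rewrite -[RHS]c2; congr (#|` _|); apply/fsetP => x.
  by rewrite !(in_fsetI, in_fsetU); have := dZ x; bool_cases.
by apply/fsetP => x; rewrite !(in_fsetU, in_fsetD); have := dZ x; bool_cases.
Qed.

(* A spectator inside a cell about to move completes it to a full cell; the    *)
(* move is then replaced by a mere change of which point counts as spectator.  *)
Lemma gamma_carry P Q R : gamma P Q -> [disjoint P & R]%fset ->
  exists R', [/\ gamma (P `|` R) (Q `|` R'), [disjoint Q & R']%fset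
               & #|` R'| = #|` R|].
Proof.
move=> g; elim: g R => {P Q} [P Q m|P|P Q S _ h1 _ h2] R dPR; last 2 first.
- by exists R; split=> //; apply: gamma_refl.
- have [R1 [g1 d1 c1]] := h1 _ dPR; have [R2 [g2 d2 c2]] := h2 _ d1.
  by exists R2; split; rewrite ?c2 //; apply: gamma_trans g2.
case: m => v [S [c2 Sv S2 ->]]; have := card_cell v.
set c := translate v cellT in c2 Sv * => c3.
have [dRc|ndRc] := boolP [disjoint R & c]%fset.
  exists R; split=> //; first by apply: rt_step; apply: move_add.
  apply/fdisjointP_in => x; rewrite in_fsetU in_fsetD => /orP[/andP[_]|].
    by move: x; apply/fdisjointP_in.
  move=> xS xR; move/fdisjointP_in: dRc; apply; first exact: xR.
  exact: (fsubsetP Sv).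
have cR : c `\` P = R `&` c.
  apply/esym/eqP; rewrite eqEfcard; apply/andP; split.
    apply/fsubsetP => x; rewrite in_fsetI in_fsetD => /andP[xR ->].
    by rewrite andbT; apply/negP => xP; move/fdisjointP_in: dPR; apply; eauto.
  have := cardfsID P c; rewrite fsetIC c2 c3.
  have : (0 < #|` R `&` c|)%N by rewrite cardfs_gt0.
  by lia.
exists ((R `\` c) `|` (c `\` S)).
have -> : (P `\` c `|` S) `|` (R `\` c `|` c `\` S) = P `|` R.
  apply/fsetP => x; rewrite !(in_fsetU, in_fsetD).
  move/fsetP: (cR) => /(_ x); move: (fsubsetP Sv x); rewrite in_fsetI in_fsetD.
  by bool_cases.
split; first exact: gamma_refl.
  apply/fdisjointP_in => x; rewrite !(in_fsetU, in_fsetD).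
  move=> /orP[/andP[xc xP]|xS]; last first.
    by rewrite xS (fsubsetP Sv _ xS).
  rewrite xc (negbTE xc) andbF orbF /= => xR.
  by move/fdisjointP_in: dPR; apply; eauto.
rewrite cardfsU; have -> : (R `\` c) `&` (c `\` S) = fset0.
  apply/fsetP => x; rewrite in_fsetI !in_fsetD in_fset0.
  by case: (x \in c); rewrite ?andbF.
have := cardfsID c R; have := cardfsID S c; rewrite -cR cardfs0.
have -> : c `&` S = S by apply/fsetIidPr.
have := cardfsID P c; rewrite [c `&` P]fsetIC c2 c3 S2; lia.
Qed.

(** Every cell used along the way lies in the filling, which never changes; so the points of [Z] are
    never in a moving cell. *)
Lemma gamma_lift P Q Z : gamma P Q -> [disjoint Z & filling P]%fset ->
  gamma (P `|` Z) (Q `|` Z).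
Proof.
elim=> {P Q} [P Q m dZ|P _|P Q S h h1 _ h2 dZ]; last 2 first.
- exact: gamma_refl.
- apply: gamma_trans (h1 dZ) _; apply: h2; by rewrite (gamma_filling h).
case: m => v [S [c2 Sv S2 ->]]; apply: rt_step; apply: move_add => //.
by apply: fdisjointWr dZ; apply: two_in_filling.
Qed.

(** * Zigzags between two adjacent parallel lines *)

Definition seg (p : nat -> point) (n : nat) : pattern :=
  [fset p i | i in iota 0 n].

Lemma segP p n x : reflect (exists2 i, (i < n)%N & x = p i) (x \in seg p n).
Proof.
apply: (iffP (imfsetP _ _ _ _)) => -[i /=]; rewrite ?mem_iota => h e;
  by exists i; rewrite //= mem_iota.
Qed.

Lemma mem_seg p n i : (i < n)%N -> p i \in seg p n.
Proof. by move=> h; apply/segP; exists i. Qed.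

Lemma seg0 p : seg p 0 = fset0.
Proof. by apply/fsetP => x; rewrite in_fset0; apply/segP => -[]. Qed.

Lemma segS p n : seg p n.+1 = p n |` seg p n.
Proof.
apply/fsetP => x; rewrite in_fset1U; apply/segP/orP => [[i]|[/eqP->|/segP[i h ->]]].
- rewrite ltnS leq_eqVlt => /orP[/eqP->->|h ->]; first by left.
  by right; apply: mem_seg.
- by exists n.
- by exists i => //; lia.
Qed.

Lemma seg_recl p n : seg p n.+1 = p 0%N |` seg (fun i => p i.+1) n.
Proof.
apply/fsetP => x; rewrite in_fset1U; apply/segP/orP => [[[|i] h ->]|].
- by left.
- by right; apply/segP; exists i.
- by case=> [/eqP->|/segP[i h ->]]; [exists 0%N|exists i.+1].
Qed.

Lemma eq_seg p q n : (forall i, (i < n)%N -> p i = q i) -> seg p n = seg q n.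
Proof.
by move=> h; apply/fsetP => x; apply/segP/segP => -[i hi ->]; exists i;
  rewrite ?h.
Qed.

Lemma card_seg p n : (forall i j, (i < n)%N -> (j < n)%N -> p i = p j -> i = j) ->
  #|` seg p n| = n.
Proof.
elim: n => [|n IH] inj; first by rewrite seg0 cardfs0.
rewrite segS cardfsU1 IH => [|i j hi hj]; last by apply: inj; lia.
by case: segP => [[i hi /inj]|] //; lia.
Qed.

(** One point [p j] on the longer line is enough to pull the whole shorter line [q] over to it, cell
    after cell in both directions from [j]. The set [Z] of spectators makes the induction on [n]
    possible, since the last point is set aside there. *)
Lemma zigzag p q n j (Z : pattern) : (j <= n)%N ->
  (forall i, (i < n)%N -> is_cell (p i) (p i.+1) (q i)) ->
  (forall i k, (i <= n)%N -> (k <= n)%N -> p i = p k -> i = k) ->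
  (forall i k, (i < n)%N -> (k < n)%N -> q i = q k -> i = k) ->
  (forall i k, (i <= n)%N -> (k < n)%N -> p i <> q k) ->
  (forall i, (i <= n)%N -> p i \notin Z) -> (forall i, (i < n)%N -> q i \notin Z) ->
  gamma (p j |` seg q n `|` Z) (seg p n.+1 `|` Z).
Proof.
elim: n j Z => [|n IH] j Z jn hc pinj qinj pq pZ qZ.
  have -> : j = 0%N by lia.
  by rewrite segS !seg0; apply: gamma_refl.
have pnq i : (i <= n)%N -> (p i == p n.+1) = false.
  by move=> h; apply/eqP => /pinj; lia.
(* If [p j] is not the last point, everything before is pulled first and then [q n] moves to
   [p n.+1] with [p n] as pivot. Otherwise [q n] first moves to [p n], which takes over the role of
   [p j]. *)
have [ltjn|] := leqP j n.
  have h1 : gamma (p j |` seg q n `|` (q n |` Z)) (seg p n.+1 `|` (q n |` Z)).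
    apply: IH => //.
    - by move=> i hi; apply: hc; lia.
    - by move=> i k hi hk; apply: pinj; lia.
    - by move=> i k hi hk; apply: qinj; lia.
    - by move=> i k hi hk; apply: pq; lia.
    - move=> i hi; rewrite in_fset1U negb_or pZ ?andbT; last lia.
      by apply/eqP; apply: pq; lia.
    - move=> i hi; rewrite in_fset1U negb_or qZ ?andbT; last lia.
      by apply/eqP => /qinj; lia.
  have -> : p j |` seg q n.+1 `|` Z = p j |` seg q n `|` (q n |` Z).
    by rewrite segS; apply/fsetP => x; rewrite !inE; bool_cases.
  apply: gamma_trans h1 _.
  have -> : seg p n.+2 `|` Z = p n.+1 |` ((seg p n.+1 `|` (q n |` Z)) `\ q n).
    rewrite (segS p n.+1); apply/fsetP => x; rewrite !inE.
    have [->|nx] := eqVneq x (q n); last by rewrite /= orbA.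
    rewrite /= orbF (negbTE (qZ _ _)) // orbF.
    case: segP => [[i hi e]|_]; last by rewrite orbF.
    by exfalso; apply: (pq i n) => //; lia.
  apply: (@gamma_move _ (p n)); first exact/is_cellCr/hc.
  - by rewrite !inE mem_seg.
  - by rewrite !inE eqxx orbT.
  - rewrite !inE !negb_or pZ // andbT; apply/andP; split; last by apply/eqP/pq.
    by apply/segP => -[i hi e]; have := pnq i; rewrite e eqxx; lia.
move=> lt; have {lt jn} -> : j = n.+1 by lia.
apply: (@gamma_trans (p n |` seg q n `|` (p n.+1 |` Z))).
  have -> : p n |` seg q n `|` (p n.+1 |` Z)
      = p n |` ((p n.+1 |` seg q n.+1 `|` Z) `\ q n).
    rewrite segS; apply/fsetP => x; rewrite !inE.
    have [->|nx] := eqVneq x (q n); last first.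
      by rewrite /=; bool_cases.
    rewrite (negbTE (qZ _ _)) //= !orbF.
    have /negbTE -> : q n != p n.+1 by rewrite eq_sym; apply/eqP/pq.
    rewrite orbF; case: segP => [[i hi]|_]; last by rewrite orbF.
    by move/qinj; lia.
  apply: (@gamma_move _ (p n.+1)); first exact/is_cellCr/is_cellC/hc.
  - by rewrite !inE eqxx.
  - by rewrite !inE mem_seg ?orbT.
  - rewrite !inE !negb_or pZ // pnq //= andbT.
    by apply/segP => -[i hi]; apply: pq.
rewrite (segS p n.+1).
have -> : p n.+1 |` seg p n.+1 `|` Z = seg p n.+1 `|` (p n.+1 |` Z).
  by rewrite fsetUA (fsetUC [fset _]).
apply: IH => //.
- by move=> i hi; apply: hc; lia.
- by move=> i k hi hk; apply: pinj; lia.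
- by move=> i k hi hk; apply: qinj; lia.
- by move=> i k hi hk; apply: pq; lia.
- by move=> i hi; rewrite in_fset1U negb_or pnq // pZ //; lia.
- move=> i hi; rewrite in_fset1U negb_or qZ ?andbT; last lia.
  by rewrite eq_sym; apply/eqP/pq; lia.
Qed.

(** * The three sides of a triangle *)

Definition line (v : point) (n : nat) : pattern :=
  seg (fun i => (v.1 + i%:Z, v.2 + n%:Z - 1)) n.

Definition column (v : point) (n : nat) : pattern :=
  seg (fun i => (v.1 + n%:Z - 1, v.2 + i%:Z)) n.

Definition diagonal (v : point) (n : nat) : pattern :=
  seg (fun i => (v.1 + i%:Z, v.2 + n%:Z - 1 - i%:Z)) n.

Arguments line v%_R n%_N.
Arguments column v%_R n%_N.
Arguments diagonal v%_R n%_N.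

Lemma in_line v n x : (x \in line v n) =
  [&& x.2 == v.2 + n%:Z - 1, v.1 <= x.1 & x.1 < v.1 + n%:Z].
Proof.
apply/segP/idP => [[i hi ->] /=|]; first by lia.
case: x => a b /= h; exists (absz (a - v.1)%R); first by lia.
by congr pair; lia.
Qed.

Lemma line_sub v n : line v n `<=` tri v n.
Proof. by apply/fsubsetP => -[a b]; rewrite in_line in_triangle /=; lia. Qed.

Lemma card_line v n : #|` line v n| = n.
Proof. by apply: card_seg => i j _ _ [] ; lia. Qed.

(** Deleting the top row of T_{n+1} leaves T_n shifted by (1,0); all inductions on triangles below
    use this splitting. *)
Lemma triS v n :
  tri v n.+1 = line v n.+1 `|` tri (v.1 + 1, v.2) n.
Proof.
by apply/fsetP => -[a b]; rewrite in_fsetU in_line !in_triangle /=; lia.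
Qed.

Lemma line_tri_disjoint v n :
  [disjoint line v n.+1 & tri (v.1 + 1, v.2) n]%fset.
Proof.
by apply/fdisjointP_in => -[a b]; rewrite in_line in_triangle /=; lia.
Qed.

Lemma tri0 v : tri v 0 = fset0.
Proof. by apply/fsetP => -[a b]; rewrite in_triangle in_fset0 /=; lia. Qed.

Lemma filling_sub_tri P v n : P `<=` tri v n -> filling P `<=` tri v n.
Proof. exact/filling_min/triangle_stable. Qed.

Lemma zigzag_line v n j : (j <= n)%N ->
  gamma (line v n.+1) ((v.1 + j%:Z, v.2 + n%:Z) |` line (v.1 + 1, v.2) n).
Proof.
move=> jn; apply: gamma_sym.
pose p (i : nat) : point := (v.1 + i%:Z, v.2 + n%:Z).
pose q (i : nat) : point := (v.1 + 1 + i%:Z, v.2 + n%:Z - 1).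
have := @zigzag p q n j fset0 jn; rewrite !fsetU0.
have -> : seg p n.+1 = line v n.+1.
  by apply: eq_seg => i _; congr pair => /=; lia.
apply=> //.
- move=> i hi; apply: (@is_cellI (v.1 + i%:Z, v.2 + n%:Z - 1));
    rewrite /p /q ?in_cell /= ?xpair_eqE; lia.
- by move=> i k _ _ []; lia.
- by move=> i k _ _ []; lia.
- by move=> i k _ _ []; lia.
Qed.

Lemma zigzag_column v n j : (j <= n)%N ->
  gamma (column (v.1, v.2 - 1) n.+1)
        ((v.1 + n%:Z, v.2 - 1 + j%:Z) |` column v n).
Proof.
move=> jn; apply: gamma_sym.
pose p (i : nat) : point := (v.1 + n%:Z, v.2 - 1 + i%:Z).
pose q (i : nat) : point := (v.1 + n%:Z - 1, v.2 + i%:Z).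
have := @zigzag p q n j fset0 jn; rewrite !fsetU0.
have -> : seg p n.+1 = column (v.1, v.2 - 1) n.+1.
  by apply: eq_seg => i _; congr pair => /=; lia.
apply=> //.
- move=> i hi; apply: (@is_cellI (v.1 + n%:Z - 1, v.2 - 1 + i%:Z));
    rewrite /p /q ?in_cell /= ?xpair_eqE; lia.
- by move=> i k _ _ []; lia.
- by move=> i k _ _ []; lia.
- by move=> i k _ _ []; lia.
Qed.

Lemma zigzag_diagonal v n j : (j <= n)%N ->
  gamma (diagonal (v.1 - 1, v.2 - 1) n.+1)
        ((v.1 - 1 + j%:Z, v.2 - 1 + n%:Z - j%:Z) |` diagonal v n).
Proof.
move=> jn; apply: gamma_sym.
pose p (i : nat) : point := (v.1 - 1 + i%:Z, v.2 - 1 + n%:Z - i%:Z).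
pose q (i : nat) : point := (v.1 + i%:Z, v.2 + n%:Z - 1 - i%:Z).
have := @zigzag p q n j fset0 jn; rewrite !fsetU0.
have -> : seg p n.+1 = diagonal (v.1 - 1, v.2 - 1) n.+1.
  by apply: eq_seg => i _; congr pair => /=; lia.
apply=> //.
- move=> i hi; apply: (@is_cellI (v.1 - 1 + i%:Z, v.2 - 1 + n%:Z - i%:Z - 1));
    rewrite /p /q ?in_cell /= ?xpair_eqE; lia.
- by move=> i k _ _ []; lia.
- by move=> i k _ _ []; lia.
- by move=> i k _ _ []; lia.
Qed.

Lemma gamma_lift1 x v n Q : x \notin tri v n -> gamma (line v n) Q ->
  gamma (x |` line v n) (x |` Q).
Proof.
move=> xt g; rewrite ![x |` _]fsetUC; apply: gamma_lift g _.
apply/fdisjointP_in => y; rewrite in_fset1 => /eqP->.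
by move/(fsubsetP (filling_sub_tri (line_sub v n))); rewrite (negbTE xt).
Qed.

(** The top row zigzags down, leaving only its right end behind; by induction the row below then
    becomes the column beneath that point. Leaving the left end instead yields the hypotenuse. *)
Lemma line_column v n : gamma (line v n) (column v n).
Proof.
elim: n v => [|n IH] v; first by rewrite /line /column !seg0; apply: gamma_refl.
apply: gamma_trans (zigzag_line v (leqnn n)) _.
have -> : column v n.+1 =
    (v.1 + n%:Z, v.2 + n%:Z) |` column (v.1 + 1, v.2) n.
  rewrite /column segS; congr (_ `|` _); first by congr [fset (_, _)]; lia.
  by apply: eq_seg => i _; congr pair => /=; lia.
by apply: gamma_lift1; rewrite ?in_triangle //=; lia.
Qed.

Lemma line_diagonal v n : gamma (line v n) (diagonal v n).
Proof.
elim: n v => [|n IH] v; first by rewrite /line /diagonal !seg0; apply: gamma_refl.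
apply: gamma_trans (zigzag_line v (leq0n n)) _.
have -> : diagonal v n.+1 =
    (v.1 + 0%:Z, v.2 + n%:Z) |` diagonal (v.1 + 1, v.2) n.
  rewrite /diagonal seg_recl; congr (_ `|` _); first by congr [fset (_, _)]; lia.
  by apply: eq_seg => i _; congr pair => /=; lia.
by apply: gamma_lift1; rewrite ?in_triangle //=; lia.
Qed.

Lemma line_reach v n y : y \in tri v n -> exists2 Q, gamma (line v n) Q & y \in Q.
Proof.
elim: n v => [|n IH] v; first by rewrite tri0.
rewrite triS in_fsetU => /orP[yl|/IH[Q g yQ]].
  by exists (line v n.+1) => //; apply: gamma_refl.
exists ((v.1 + 0%:Z, v.2 + n%:Z) |` Q); last by rewrite in_fset1U yQ orbT.
apply: gamma_trans (zigzag_line v (leq0n n)) _.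
by apply: gamma_lift1 => //; rewrite in_triangle /=; lia.
Qed.

(** Each point of the triangle is occupied somewhere in the orbit of the top row, and the filling is
    constant on that orbit. *)
Lemma filling_line v n : filling (line v n) = tri v n.
Proof.
apply/eqP; rewrite eqEfsubset filling_sub_tri ?line_sub //=.
apply/fsubsetP => y /line_reach[Q g yQ].
by rewrite -(gamma_filling g); apply: (fsubsetP (sub_filling Q)).
Qed.

Lemma filling_between v n P : line v n `<=` P -> P `<=` tri v n ->
  filling P = tri v n.
Proof.
move=> lP Pt; apply/eqP; rewrite eqEfsubset filling_sub_tri //=.
by rewrite -filling_line filling_mono.
Qed.

(** The point [y] lies on the line just beyond one of the three sides. The top row is turned into
    that side, [y] starts a zigzag that makes it one longer, and the result is turned back into a
    top row. *)
Lemma line_grow v n x y : x \in tri v n -> y \in neighbours x ->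
  y \notin tri v n ->
  exists w, gamma (y |` line v n) (line w n.+1) /\ tri v n `<=` tri w n.+1.
Proof.
case: v x y => [c d] [a b] [x y]; rewrite in_neighbours => abt nb nt.
have : x - c = n%:Z \/ y - d = n%:Z \/ (x - c) + (y - d) = n%:Z - 2.
  by move: abt nt nb; rewrite !in_triangle /= !inE !xpair_eqE; lia.
move: abt nb (nt); rewrite !in_triangle /= !inE !xpair_eqE => abt nb nt' hs.
case: hs => [hA|[hB|hC]].
- exists (c, d - 1); split; last first.
    by apply/fsubsetP => -[p q]; rewrite !in_triangle /=; lia.
  apply: gamma_trans (gamma_lift1 nt (line_column (c, d) n)) _.
  apply: gamma_trans (gamma_sym (line_column _ _)).
  (* The new column starts at height [d - 1], so [y - d + 1] is the index of the point in it. *)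
  have := @zigzag_column (c, d) n (absz (y - d + 1)%R); rewrite /=.
  have -> : (c + n%:Z, d - 1 + ((absz (y - d + 1)%R))%:Z) = (x, y).
    by congr pair; lia.
  by move=> h; apply/gamma_sym/h; lia.
- exists (c - 1, d); split; last first.
    by apply/fsubsetP => -[p q]; rewrite !in_triangle /=; lia.
  have := @zigzag_line (c - 1, d) n (absz (x - c + 1)%R); rewrite /= subrK.
  have -> : (c - 1 + ((absz (x - c + 1)%R))%:Z, d + n%:Z) = (x, y).
    by congr pair; lia.
  by move=> h; apply/gamma_sym/h; lia.
- exists (c - 1, d - 1); split; last first.
    by apply/fsubsetP => -[p q]; rewrite !in_triangle /=; lia.
  apply: gamma_trans (gamma_lift1 nt (line_diagonal (c, d) n)) _.
  apply: gamma_trans (gamma_sym (line_diagonal _ _)).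
  have := @zigzag_diagonal (c, d) n (absz (x - c + 1)%R); rewrite /=.
  have -> : (c - 1 + ((absz (x - c + 1)%R))%:Z,
             d - 1 + n%:Z - ((absz (x - c + 1)%R))%:Z) = (x, y).
    by congr pair; lia.
  by move=> h; apply/gamma_sym/h; lia.
Qed.

(** * Transport between the top row and the triangle below it *)

Section TwoRows.

Variables (v : point) (n : nat).

Let p (i : nat) : point := (v.1 + i%:Z, v.2 + n%:Z).
Let q (i : nat) : point := (v.1 + 1 + i%:Z, v.2 + n%:Z - 1).
Let top := line v n.+1.
Let row := line (v.1 + 1, v.2) n.
Let low := tri (v.1 + 1, v.2) n.

Let pE i j : (p i == p j) = (i == j).
Proof. by rewrite xpair_eqE; lia. Qed.

Let p_top i : (i <= n)%N -> p i \in top.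
Proof. by move=> h; rewrite in_line /=; lia. Qed.

Let topP x : x \in top -> exists2 i, (i <= n)%N & x = p i.
Proof. by case/segP=> i hi ->; exists i => //; congr pair; lia. Qed.

Let q_row i : (i < n)%N -> q i \in row.
Proof. by move=> h; rewrite in_line /=; lia. Qed.

Let row_low : row `<=` low.
Proof. exact: line_sub. Qed.

Let top_low x : x \in top -> x \notin low.
Proof.
by move=> xt; apply/negP; move/fdisjointP_in: (line_tri_disjoint v n); apply.
Qed.

Let cell_pq i : (i < n)%N -> is_cell (p i) (p i.+1) (q i).
Proof.
move=> hi; apply: (@is_cellI (v.1 + i%:Z, v.2 + n%:Z - 1));
  rewrite /p /q ?in_cell /= ?xpair_eqE; lia.
Qed.

Lemma top_step i (A : pattern) : (i < n)%N -> A `<=` top ->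
  p i \in A -> p i.+1 \notin A ->
  gamma (A `|` row) ((p i.+1 |` (A `\ p i)) `|` row).
Proof.
move=> hi At pA pA'.
have nrow j : (j <= n)%N -> p j \notin row.
  by move=> /p_top/top_low; apply: contra; apply: (fsubsetP row_low).
have -> : (p i.+1 |` (A `\ p i)) `|` row = p i.+1 |` ((A `|` row) `\ p i).
  apply/fsetP => x; rewrite !inE; have := nrow i (ltnW hi).
  by have [->|_] := eqVneq x (p i); bool_cases.
apply: (@gamma_move _ (q i)); first exact/is_cellC/is_cellCr/cell_pq.
- by rewrite in_fsetU q_row ?orbT.
- by rewrite in_fsetU pA.
- by rewrite in_fsetU negb_or pA' nrow.
Qed.

(** An occupied position next to the target is no obstacle: its point advances to the target first,
    and the travelling point then replaces it. *)
Lemma top_exchange i j (A : pattern) : (i < j)%N -> (j <= n)%N ->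
  A `<=` top -> p i \in A -> p j \notin A ->
  gamma (A `|` row) ((p j |` (A `\ p i)) `|` row).
Proof.
move=> ij; have -> : j = (i + (j - i.+1)).+1 by rewrite -addSn subnKC.
move: (j - i.+1)%N => d {j ij}; elim: d A => [|d IH] A hd At pA pA'.
  by rewrite addn0 in hd pA' *; apply: top_step.
rewrite addnS in hd pA' *; set a := p i; set c := p (i + d).+1.
set b := p (i + d).+2; have [ac cb ab] : [/\ a != c, c != b & a != b].
  by rewrite !pE; split; lia.
have sub x y : x \in top -> x |` (A `\ y) `<=` top.
  move=> xt; rewrite fsubUset fsub1set xt /=.
  exact: fsubset_trans (fsubD1set _ _) At.
have [cA|cA] := boolP (c \in A).
  apply: gamma_trans (top_step hd At cA pA') _.
  have -> : b |` (A `\ a) = c |` ((b |` (A `\ c)) `\ a).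
    apply/fsetP => x; rewrite !inE; have [->|_] := eqVneq x c.
      by rewrite (negbTE cb) cA eq_sym ac.
    have [->|_] := eqVneq x b; last by [].
    by rewrite eq_sym ab.
  apply: IH; first lia.
  - by apply: sub; apply: p_top; lia.
  - by rewrite !inE pA ac orbT.
  - by rewrite !inE eqxx (negbTE cb).
apply: (@gamma_trans ((c |` (A `\ a)) `|` row)).
  by apply: IH => //; lia.
have -> : b |` (A `\ a) = b |` ((c |` (A `\ a)) `\ c).
  apply/fsetP => x; rewrite !inE; have [->|//] := eqVneq x c.
  by rewrite (negbTE cA) andbF.
apply: top_step => //.
- by apply: sub; apply: p_top; lia.
- by rewrite !inE eqxx.
- by rewrite !inE (negbTE pA') andbF orbF eq_sym.
Qed.

Lemma top_connect (A B : pattern) : A `<=` top -> B `<=` top ->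
  #|` A| = #|` B| -> gamma (A `|` row) (B `|` row).
Proof.
have [m] := ubnP #|` A `\` B|; elim: m => // m IH in A *.
rewrite ltnS => le_m At Bt cAB.
have [e|/fset0Pn[a]] := eqVneq (A `\` B) fset0.
  have -> : A = B; last exact: gamma_refl.
  apply/eqP; rewrite eqEfcard cAB leqnn andbT; apply/fsubsetP => x xA.
  by apply/negPn/negP => xB; have := in_fset0 x; rewrite -e in_fsetD xA xB.
move=> aAB; move: (aAB); rewrite in_fsetD => /andP[aB aA].
have /fset0Pn[b] : B `\` A != fset0.
  rewrite -cardfs_gt0; have := cardfsID A B; have := cardfsID B A.
  rewrite [B `&` A]fsetIC; have := cardfsD1 a (A `\` B); rewrite aAB.
  by lia.
rewrite in_fsetD => /andP[bA bB].
have ab : a != b by apply: contra aB => /eqP->.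
pose A1 := b |` (A `\ a).
have A1t : A1 `<=` top.
  rewrite fsubUset fsub1set (fsubsetP Bt) //=.
  exact: fsubset_trans (fsubD1set _ _) At.
apply: (@gamma_trans (A1 `|` row)); last first.
  apply: IH => //; last by rewrite cardfsU1 !inE (negbTE bA) andbF -cAB
    (cardfsD1 a A) aA.
  have -> : A1 `\` B = (A `\` B) `\ a.
    apply/fsetP => x; rewrite !inE.
    by have [->|] := eqVneq x b; rewrite ?bB ?andbF //= andbCA.
  by move: le_m; rewrite (cardfsD1 a) aAB.
have [i hi ai] := topP (fsubsetP At _ aA).
have [j hj bj] := topP (fsubsetP Bt _ bB).
have : i != j by rewrite -pE -ai -bj.
rewrite neq_ltn => /orP[lt|lt].
  by rewrite /A1 ai bj; apply: top_exchange; rewrite -?ai -?bj.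
apply: gamma_sym.
have -> : A = a |` (A1 `\ b).
  apply/fsetP => x; rewrite !inE; have [->|_] := eqVneq x a; first by [].
  by have [->|] := eqVneq x b; rewrite //= (negbTE bA).
rewrite ai bj; apply: top_exchange; rewrite -?ai -?bj //.
- by rewrite !inE eqxx.
- by rewrite !inE (negbTE ab) eqxx.
Qed.

Lemma top_boundary (A : pattern) : A `<=` top -> A != fset0 -> A != top ->
  exists2 i, (i < n)%N & (p i \in A) != (p i.+1 \in A).
Proof.
move=> At /fset0Pn[a aA] nA.
have [//|no] := pselect (exists2 i, (i < n)%N & (p i \in A) != (p i.+1 \in A)).
have h i : (i <= n)%N -> (p i \in A) = (p 0 \in A).
  elim: i => // i IH hi; rewrite -IH; last by lia.
  by apply/esym/eqP/negPn/negP => ne; apply: no; exists i.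
case/negP: nA; rewrite eqEfsubset At; apply/fsubsetP => x /topP[i hi ->].
have [j hj aj] := topP (fsubsetP At _ aA).
by rewrite h // -(h j) // -aj.
Qed.

(** This cell refills [q i] from the row below, using a neighbour of [q i] in its own row as pivot.
    The left end has no left neighbour and uses [q 1]. *)
Let lower_cell i : (1 < n)%N -> (i < n)%N ->
  exists s y, [/\ is_cell s y (q i), s \in row, y \in low & y \notin row].
Proof.
move=> n1; case: i => [|i] hi.
  exists (q 1), (v.1 + 2, v.2 + n%:Z - 2); split.
  - apply: (@is_cellI (v.1 + 1, v.2 + n%:Z - 2));
      rewrite /p /q ?in_cell /= ?xpair_eqE; lia.
  - exact: q_row.
  - by rewrite in_triangle /=; lia.
  - by rewrite in_line /=; lia.
exists (q i), (v.1 + 1 + i.+1%:Z, v.2 + n%:Z - 2); split.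
- apply: (@is_cellI (v.1 + 1 + i%:Z, v.2 + n%:Z - 2));
    rewrite /p /q ?in_cell /= ?xpair_eqE; lia.
- by apply: q_row; lia.
- by rewrite in_triangle /=; lia.
- by rewrite in_line /=; lia.
Qed.

(* A point of the top row is won by borrowing it from the row below, which is  *)
(* repaired with one of the points lying still deeper.                         *)
Lemma push_up (A B : pattern) :
  (forall C, row `<=` C -> C `<=` low -> #|` C| = #|` B| -> gamma B C) ->
  A `<=` top -> A != fset0 -> A != top ->
  row `<=` B -> B `<=` low -> B != row ->
  exists A' B', [/\ A' `<=` top, A' != fset0, row `<=` B' /\ B' `<=` low,
    (#|` B'| < #|` B|)%N & gamma (A `|` B) (A' `|` B')].
Proof.
move=> conn At A0 nA rB Bl nB.
have /fset0Pn[y0] : B `\` row != fset0.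
  apply: contra nB => /eqP e; rewrite eqEfsubset rB andbT.
  apply/fsubsetP => x xB; apply/negPn/negP => xr.
  by have := in_fset0 x; rewrite -e in_fsetD xr xB.
rewrite in_fsetD => /andP[y0r y0B].
have n1 : (1 < n)%N.
  have := fsubsetP Bl _ y0B; move: y0r; case: (y0) => a b.
  by rewrite in_line in_triangle /=; lia.
have [i hi ne] := top_boundary At A0 nA.
have [s [y [csy sr yl yr]]] := lower_cell n1 hi.
(* Connectivity of the lower triangle allows a surplus point to be placed exactly at [y]. *)
have [C [rC Cl cC yC]] : exists C, [/\ row `<=` C, C `<=` low,
    #|` C| = #|` B| & y \in C].
  have [yB|yB] := boolP (y \in B); first by exists B.
  exists (y |` (B `\ y0)); split.
  - apply/fsubsetP => x xr; rewrite !inE (fsubsetP rB _ xr) andbT.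
    by apply/orP; right; apply: contraNneq y0r => <-.
  - rewrite fsubUset fsub1set yl; exact: fsubset_trans (fsubD1set _ _) Bl.
  - by rewrite cardfsU1 !inE (negbTE yB) andbF (cardfsD1 y0 B) y0B.
  - by rewrite !inE eqxx.
have disjA D : D `<=` low -> [disjoint A & filling D]%fset.
  move=> /filling_sub_tri Dl; apply/fdisjointP_in => x xA /(fsubsetP Dl).
  by apply/negP/top_low/(fsubsetP At).
have gBC : gamma (A `|` B) (A `|` C).
  by rewrite ![A `|` _]fsetUC; apply: gamma_lift (conn C rC Cl cC) (disjA _ Bl).
have [pin [pout [cp pinA poutA poutt]]] : exists pin pout,
    [/\ is_cell pin (q i) pout, pin \in A, pout \notin A & pout \in top].
  have cpq := cell_pq hi; move: ne.
  have [pA|pA] := boolP (p i \in A) => ne.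
    exists (p i), (p i.+1); split=> //; last exact: p_top.
    exact: is_cellCr.
  exists (p i.+1), (p i); split=> //; last exact/p_top/ltnW.
    exact/is_cellCr/is_cellC.
  by move: ne; case: (p i.+1 \in A).
have qr := q_row hi; have ql := fsubsetP row_low _ qr.
have nA' x : x \in low -> x \notin A.
  by apply: contraL => /(fsubsetP At)/top_low.
have ntop x : x \in low -> (x == pout) = false.
  by move=> xl; apply: contraTF xl => /eqP->; apply: top_low.
have [sq yq sy] : [/\ s != q i, y != q i & s != y].
  by case: csy => w [_ []].
exists (pout |` A), (C `\ y); split.
- by rewrite fsubUset fsub1set poutt.
- by apply/fset0Pn; exists pout; rewrite !inE eqxx.
- split; last exact: fsubset_trans (fsubD1set _ _) Cl.
  apply/fsubsetP => x xr; rewrite !inE (fsubsetP rC _ xr) andbT.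
  by apply: contraNneq yr => <-.
- by rewrite -cC (cardfsD1 y C) yC.
apply: gamma_trans gBC _.
apply: (@gamma_trans (pout |` ((A `|` C) `\ q i))).
  apply: (gamma_move cp); rewrite in_fsetU ?pinA ?(fsubsetP rC _ qr) ?orbT //.
  rewrite negb_or poutA; apply/negP => /(fsubsetP Cl).
  by apply/negP/top_low.
have -> : (pout |` A) `|` (C `\ y) =
    q i |` ((pout |` ((A `|` C) `\ q i)) `\ y).
  apply/fsetP => x; rewrite !inE.
  have [->|_] := eqVneq x (q i).
    by rewrite (fsubsetP rC _ qr) [_ == y]eq_sym yq /= orbT.
  have [->|_] := eqVneq x y; last by rewrite /= orbA.
  by rewrite ntop // (negbTE (nA' _ _)).
apply: (gamma_move csy); rewrite !inE.
- by rewrite sq (fsubsetP rC _ sr) !orbT.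
- by rewrite yq yC !orbT.
- by rewrite eqxx ntop.
Qed.

(** Pumping points upwards ends only when the top row is full or nothing is left to pump. This
    leaves so little freedom that |Q| essentially fixes the result. *)
Lemma top_normal (Q : pattern) :
  (forall B C, row `<=` B -> B `<=` low -> row `<=` C -> C `<=` low ->
     #|` B| = #|` C| -> gamma B C) ->
  top `<=` Q -> Q `<=` tri v n.+1 ->
  exists A B, [/\ A `<=` top, row `<=` B /\ B `<=` low,
     gamma Q (A `|` B) & A = top \/ B = row].
Proof.
move=> conn tQ Qt.
have [A [B [At A0 [rB Bl] gQ]]] : exists A B, [/\ A `<=` top, A != fset0,
    row `<=` B /\ B `<=` low & gamma Q (A `|` B)].
  (* Zigzagging the top row down completes the row below and keeps a point on top; the other points
     of [Q] are carried along and cannot leave the filling. *)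
  have dQ : [disjoint top & Q `\` top]%fset.
    by apply/fdisjointP_in => x xt; rewrite in_fsetD xt.
  have [R [gR _ _]] := gamma_carry (zigzag_line v (leq0n n)) dQ.
  set X := _ `|` R in gR.
  have {}gR : gamma Q X.
    suff -> : Q = top `|` (Q `\` top) by [].
    apply/fsetP => x; rewrite !inE; have := fsubsetP tQ x; bool_cases.
  have Xt : X `<=` top `|` low.
    rewrite -triS -(filling_between tQ Qt) -(gamma_filling gR).
    exact: sub_filling.
  exists (X `&` top), (X `&` low); split.
  - exact: fsubsetIr.
  - apply/fset0Pn; exists (p 0); rewrite in_fsetI p_top // andbT.
    by rewrite !inE eqxx.
  - split; last exact: fsubsetIr.
    apply/fsubsetP => x xr; rewrite in_fsetI (fsubsetP row_low) // andbT.
    by rewrite !inE; move: xr; rewrite /row => ->; rewrite orbT.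
  - by rewrite -fsetIUr; have /fsetIidPl -> := Xt.
have [m] := ubnP #|` B|; elim: m => // m IH in A B At A0 rB Bl gQ *.
rewrite ltnS => le_m.
have [eA|nA] := eqVneq A top; first by exists A, B; split=> //; left.
have [eB|nB] := eqVneq B row; first by exists A, B; split=> //; right.
have [|A' [B' [A't A'0 [rB' B'l] lt g]]] := push_up _ At A0 nA rB Bl nB.
  by move=> C rC Cl cC; apply: conn.
apply: (IH A' B') => //; last exact: leq_trans lt le_m.
exact: gamma_trans gQ g.
Qed.

End TwoRows.

(** * Patterns of equal size in a triangle *)

Lemma triangle_connect n v (P Q : pattern) :
  line v n `<=` P -> P `<=` tri v n -> line v n `<=` Q -> Q `<=` tri v n ->
  #|` P| = #|` Q| -> gamma P Q.
Proof.
elim: n v P Q => [|n IH] v P Q lP Pt lQ Qt cPQ.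
  have e0 X : X `<=` tri v 0 -> X = fset0 by rewrite tri0 fsubset0 => /eqP.
  by rewrite (e0 P) // (e0 Q) //; apply: gamma_refl.
have conn := IH (v.1 + 1, v.2).
have {}conn : forall B C, line (v.1 + 1, v.2) n `<=` B ->
    B `<=` tri (v.1 + 1, v.2) n -> line (v.1 + 1, v.2) n `<=` C ->
    C `<=` tri (v.1 + 1, v.2) n -> #|` B| = #|` C| -> gamma B C.
  by move=> B C *; apply: conn.
have [A [B [At [rB Bl] gP hP]]] := top_normal conn lP Pt.
have [A' [B' [A't [rB' B'l] gQ hQ]]] := top_normal conn lQ Qt.
have dis X Y : X `<=` line v n.+1 -> Y `<=` tri (v.1 + 1, v.2) n ->
    [disjoint X & Y]%fset.
  move=> Xl Yl; apply: fdisjointWl Xl _; apply: fdisjointWr Yl _.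
  exact: line_tri_disjoint.
have card X Y : X `<=` line v n.+1 -> Y `<=` tri (v.1 + 1, v.2) n ->
    #|` X `|` Y| = (#|` X| + #|` Y|)%N.
  move=> Xl Yl; rewrite cardfsU; have := dis X Y Xl Yl; rewrite /fdisjoint.
  by move=> /eqP->; rewrite cardfs0 subn0.
have cP := gamma_card gP; have cQ := gamma_card gQ.
rewrite !card // in cP cQ.
have leA := fsubset_leq_card At; have leA' := fsubset_leq_card A't.
have leB := fsubset_leq_card rB; have leB' := fsubset_leq_card rB'.
have full X : X `<=` line v n.+1 ->
    (#|` line v n.+1| <= #|` X|)%N -> X = line v n.+1.
  by move=> Xl cX; apply/eqP; rewrite eqEfcard Xl.
apply: gamma_trans gP _; apply: gamma_trans (gamma_sym gQ).
(* If the two normal forms are of different kinds, equality of sizes forces both top rows to be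
   full. *)
have [[eB eB']|[eA eA']] : B = line (v.1 + 1, v.2) n /\
    B' = line (v.1 + 1, v.2) n \/ A = line v n.+1 /\ A' = line v n.+1.
- case: hP hQ => h [] h'; first by right.
  + right; split=> //; apply: full => //; move: cP cQ; rewrite h h'.
    by move: leB cPQ; clear; lia.
  + right; split=> //; apply: full => //; move: cP cQ; rewrite h h'.
    by move: leB' cPQ; clear; lia.
  + by left.
- rewrite eB eB'; apply: top_connect => //.
  by move: cP cQ cPQ; rewrite eB eB'; clear; lia.
rewrite eA eA' ![line v n.+1 `|` _]fsetUC; apply: gamma_lift.
  by apply: conn => //; move: cP cQ cPQ; rewrite eA eA'; clear; lia.
by apply: dis => //; apply: filling_sub_tri.
Qed.

(** * Counting points of T_n and of P_{n,k} *)

Lemma triangular_number n :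
  ((n.+1 * (n.+1 - 1)) %/ 2 = n + (n * (n - 1)) %/ 2)%N.
Proof. by rewrite -divnMDl //; congr (_ %/ 2)%N; nia. Qed.

Lemma card_tri v n : #|` tri v n| = (n + (n * (n - 1)) %/ 2)%N.
Proof.
elim: n v => [|n IH] v; first by rewrite tri0 cardfs0.
rewrite triS cardfsU card_line IH -triangular_number.
by have /eqP -> := line_tri_disjoint v n; rewrite cardfs0 subn0.
Qed.

Lemma translate0 A : translate 0 A = A.
Proof. by apply/fsetP => x; rewrite in_translate subr0. Qed.

Lemma card_translate v A : #|` translate v A| = #|` A|.
Proof. by rewrite card_imfset //=; apply: addrI. Qed.

Lemma card_fset_uniq (s : seq point) : uniq s -> #|` [fset x in s]| = size s.
Proof. by move=> us; rewrite card_fseq undup_id. Qed.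

Lemma lower_rows_uniq n : uniq (lower_rows n).
Proof.
apply: filter_uniq; apply: allpairs_uniq; rewrite ?rev_uniq ?iota_uniq //.
by move=> [a b] [c d] _ _ /= [-> ->].
Qed.

Lemma mem_lower_rows n x :
  (x \in lower_rows n) = (x \in triangle n) && (x \notin line 0 n).
Proof.
rewrite mem_filter -(translate0 (triangle n)); case: x => a b.
rewrite in_line in_triangle /= !subr0 !add0r.
apply/andP/andP => [[h /allpairsP[[i j] /= [hi hj [ea eb]]]]|[h h']].
  by move: hi hj; rewrite !mem_rev !mem_iota; split=> //; lia.
split=> //; apply/allpairsP; exists (absz b, absz a).
by rewrite /= !mem_rev !mem_iota; split; [lia|lia|congr pair; lia].
Qed.

Lemma Ppattern_line n k :
  Ppattern n k = line 0 n `|` [fset x in take k (lower_rows n)].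
Proof. by congr (_ `|` _); apply: eq_seg => i _ /=; rewrite !add0r. Qed.

Lemma size_lower_rows n : size (lower_rows n) = ((n * (n - 1)) %/ 2)%N.
Proof.
rewrite -card_fset_uniq ?lower_rows_uniq //.
have -> : [fset x in lower_rows n] = tri 0 n `\` line 0 n.
  by apply/fsetP => x; rewrite !inE mem_lower_rows translate0 andbC.
have := cardfsID (line 0 n) (tri 0 n).
have /fsetIidPr -> := line_sub 0 n.
by rewrite card_line card_tri; lia.
Qed.

Lemma card_Ppattern n k : (k <= (n * (n - 1)) %/ 2)%N ->
  #|` Ppattern n k| = (n + k)%N.
Proof.
move=> hk; rewrite Ppattern_line cardfsU card_line.
have -> : line 0 n `&` [fset x in take k (lower_rows n)] = fset0.
  apply/fsetP => x; rewrite !inE; apply/negP => /andP[xl /mem_take].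
  by rewrite mem_lower_rows xl andbF.
rewrite cardfs0 subn0 card_fset_uniq ?take_uniq ?lower_rows_uniq //.
by rewrite size_takel // size_lower_rows.
Qed.

Lemma line_sub_Ppattern v n k : line v n `<=` translate v (Ppattern n k).
Proof.
apply/fsubsetP => x; rewrite in_translate Ppattern_line in_fsetU !in_line /=.
by move=> h; apply/orP; left; lia.
Qed.

Lemma Ppattern_sub_tri v n k : translate v (Ppattern n k) `<=` tri v n.
Proof.
apply/fsubsetP => x; rewrite !in_translate Ppattern_line in_fsetU.
move=> /orP[/(fsubsetP (line_sub 0 n))|]; first by rewrite translate0.
by rewrite inE => /mem_take; rewrite mem_lower_rows => /andP[].
Qed.

(** * Maximal cores *)

(** Disjointness is demanded separately because a point is not its own neighbour. *)
Definition far (A B : pattern) : Prop :=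
  forall x y, x \in A -> y \in B -> (x != y) && (y \notin neighbours x).

Lemma neighbours_sym x y : (y \in neighbours x) = (x \in neighbours y).
Proof.
by case: x y => a b [c d]; rewrite !in_neighbours /= !inE !xpair_eqE; lia.
Qed.

Lemma far_sym A B : far A B -> far B A.
Proof. by move=> h x y xB yA; rewrite eq_sym neighbours_sym h. Qed.

Lemma far_disjoint A B : far A B -> [disjoint A & B]%fset.
Proof.
by move=> h; apply/fdisjointP_in => x xA /(h _ _ xA); rewrite eqxx.
Qed.

Lemma cell_neighbours v x y : x \in translate v cellT ->
  y \in translate v cellT -> x != y -> y \in neighbours x.
Proof.
case: v x y => [u w] [a b] [c d].
by rewrite !in_cell in_neighbours /= !inE !xpair_eqE; lia.
Qed.

Definition core_split (P : pattern) v n (C R : pattern) : Prop :=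
  [/\ (0 < n)%N, line v n `<=` C, C `<=` tri v n, [disjoint C & R]%fset
    & gamma P (C `|` R)].

Definition max_core P m : Prop :=
  forall v n C R, core_split P v n C R -> (#|` C| <= m)%N.

Lemma max_core_split P : P != fset0 ->
  exists v n C R, core_split P v n C R /\ max_core P #|` C|.
Proof.
move=> /fset0Pn[x xP].
pose rep m := `[< exists v n C R, core_split P v n C R /\ #|` C| = m >].
have ex : exists m, rep m.
  exists 1%N; apply/asboolP; exists x, 1%N, [fset x], (P `\ x).
  rewrite cardfs1; split=> //; split=> //.
  - by apply/fsubsetP => -[a b]; rewrite in_line inE; case: (x) => c d /=;
      rewrite xpair_eqE; lia.
  - by apply/fsubsetP => y; rewrite inE => /eqP->; rewrite in_triangle !subrr.
  - by apply/fdisjointP_in => y; rewrite !inE => ->.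
  - by rewrite fsetD1K //; apply: gamma_refl.
have ub m : rep m -> (m <= #|` P|)%N.
  move=> /asboolP[v [n [C [R [[_ _ _ _ g] <-]]]]].
  by rewrite -(gamma_card g) fsubset_leq_card ?fsubsetUl.
have [m /asboolP[v [n [C [R [h <-]]]]] hmax] := ex_maxnP ex ub.
exists v, n, C, R; split=> // v' n' C' R' h'.
by apply: hmax; apply/asboolP; exists v', n', C', R'.
Qed.

(** Otherwise a point [y] of [R] in or next to the triangle would give a core with one more point,
    either directly or by growing the triangle. *)
Lemma max_core_far P v n C R : core_split P v n C R -> max_core P #|` C| ->
  far (tri v n) R.
Proof.
move=> [n0 lC Ct dCR g] hmax x y xt yR.
have yC : y \notin C.
  by apply/negP => yC; move/fdisjointP_in: dCR; apply; eauto.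
have eU : (y |` C) `|` (R `\ y) = C `|` R.
  by apply/fsetP => z; rewrite !inE; have [->|] := eqVneq z y;
    rewrite ?yR ?orbT.
have dU : [disjoint y |` C & R `\ y]%fset.
  apply/fdisjointP_in => z; rewrite !inE => /orP[->//|zC] /andP[_ zR].
  by move/fdisjointP_in: dCR; apply; eauto.
have cU : #|` y |` C| = #|` C|.+1 by rewrite cardfsU1 yC.
have yt : y \notin tri v n.
  apply/negP => yt; suff /hmax : core_split P v n (y |` C) (R `\ y).
    by rewrite cU ltnn.
  split=> //; last by rewrite eU.
    exact: fsubset_trans lC (fsubsetU1 _ _).
  by rewrite fsubUset fsub1set yt.
apply/andP; split; first by apply: contraNneq yt => <-.
apply/negP => xy; have [w [gw tw]] := line_grow xt xy yt.
have dl : [disjoint y |` line v n & C `\` line v n]%fset.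
  apply/fdisjointP_in => z; rewrite !inE => /orP[/eqP->|->] //.
  by rewrite (negbTE yC) andbF.
(* The points of [C] below its top row are spectators while [y] is absorbed; further down, the rest
   of [R] plays the same role. *)
have [E [gE dE _]] := gamma_carry gw dl.
have eC : (y |` line v n) `|` (C `\` line v n) = y |` C.
  apply/fsetP => z; rewrite !inE; have := fsubsetP lC z; bool_cases.
rewrite eC in gE; set D := _ `|` E in gE.
(* Displaced points cannot escape: the filling is unchanged and was already inside the larger
   triangle. *)
have Dt : D `<=` tri w n.+1.
  apply: fsubset_trans (sub_filling D) _; rewrite (gamma_filling gE).
  apply: filling_sub_tri; rewrite fsubUset fsub1set (fsubset_trans Ct tw) andbT.
  rewrite -filling_line (gamma_filling gw).
  by apply: (fsubsetP (sub_filling _)); rewrite !inE eqxx.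
have [R' [gR dR _]] := gamma_carry gE dU.
suff /hmax : core_split P w n.+1 D R' by rewrite (gamma_card gE) cU ltnn.
split=> //.
  exact: fsubsetUl.
by apply: gamma_trans g _; rewrite -eU.
Qed.

(** Two points of one cell are neighbours, so a cell in which [R] moves contains no point of [C].
    Maximality applies anew after each move. *)
Lemma max_core_gamma P v n C R Q : max_core P #|` C| -> gamma R Q ->
  core_split P v n C R -> core_split P v n C Q.
Proof.
move=> hmax; elim=> {R Q} [R Q m h||R Q S _ h1 _ h2 /h1/h2] //.
have hfar := max_core_far h hmax; case: h => n0 lC Ct dCR g.
case: m => u [S [c2 Su S2 ->]].
have [y [_ [_ + _]]] := card2_elems c2; rewrite in_fsetI => /andP[yR yu].
have dCu : [disjoint C & translate u cellT]%fset.
  apply/fdisjointP_in => x xC xu.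
  have /andP[xy] := hfar x y (fsubsetP Ct _ xC) yR.
  by rewrite (cell_neighbours xu).
split=> //.
  apply/fdisjointP_in => x xC; rewrite in_fsetU in_fsetD.
  move=> /orP[/andP[_ xR]|/(fsubsetP Su) xu].
    by move/fdisjointP_in: dCR; apply; eauto.
  by move/fdisjointP_in: dCu; apply; eauto.
apply: gamma_trans g _; rewrite ![C `|` _]fsetUC; apply: rt_step.
exact: move_add.
Qed.

(** * Separated unions of translates of P_{n,k} *)

Notation dtri t := (tri t.1.1 t.1.2).
Notation dpat t := (translate t.1.1 (Ppattern t.1.2 t.2)).

Definition separated (D : seq (point * nat * nat)) : Prop :=
  [/\ uniq D, forall t, t \in D -> (0 < t.1.2)%N /\
        (t.2 <= (t.1.2 * (t.1.2 - 1)) %/ 2)%N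
    & forall t u, t \in D -> u \in D -> t != u -> far (dtri t) (dtri u)].

Lemma filling_Ppattern v n k : filling (translate v (Ppattern n k)) = tri v n.
Proof.
by apply: filling_between; [apply: line_sub_Ppattern|apply: Ppattern_sub_tri].
Qed.

Lemma sub_bigfcup (I : eqType) (s : seq I) (F : I -> pattern) i :
  i \in s -> F i `<=` \bigcup_(j <- s) F j.
Proof.
by move=> si; apply/fsubsetP => x xF; apply/bigfcupP; exists i; rewrite ?si.
Qed.

(** The union of the triangles is stable since two points of a cell are neighbours and hence belong
    to the same triangle. *)
Lemma filling_separated D : separated D ->
  filling (\bigcup_(t <- D) dpat t) = \bigcup_(t <- D) dtri t.
Proof.
move=> [_ _ sep]; apply/eqP; rewrite eqEfsubset; apply/andP; split.
  apply: filling_min.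
    apply: fill_stableI => u x y z xu yu zu xy.
    move=> /bigfcupP[t /andP[tD _] xt] /bigfcupP[t' /andP[t'D _] yt].
    have [e|ne] := eqVneq t t'; last first.
      by have := sep _ _ tD t'D ne x y xt yt; rewrite (cell_neighbours xu) ?andbF.
    apply: (fsubsetP (@sub_bigfcup _ D (fun t => dtri t) _ tD)); rewrite -e in yt.
    exact: (stable_cell (@triangle_stable _ _) xu yu zu xy).
  apply/fsubsetP => x /bigfcupP[t /andP[tD _] xt].
  apply: (fsubsetP (@sub_bigfcup _ D (fun t => dtri t) _ tD)).
  exact: (fsubsetP (Ppattern_sub_tri _ _ _) _ xt).
apply/fsubsetP => x /bigfcupP[t /andP[tD _] xt].
rewrite -(filling_Ppattern _ _ t.2) in xt; apply: (fsubsetP _ _ xt).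
exact/filling_mono/(@sub_bigfcup _ D (fun t => dpat t)).
Qed.

Lemma separated_reach D y : y \in \bigcup_(t <- D) dtri t ->
  exists2 Q, gamma (\bigcup_(t <- D) dpat t) Q & y \in Q.
Proof.
move=> /bigfcupP[t /andP[tD _] /line_reach[Z g yZ]].
set X := \bigcup_(t <- D) dpat t.
have lX : line t.1.1 t.1.2 `<=` X.
  apply: fsubset_trans (line_sub_Ppattern _ _ t.2) _.
  exact: (@sub_bigfcup _ D (fun t => dpat t)).
have dX : [disjoint line t.1.1 t.1.2 & X `\` line t.1.1 t.1.2]%fset.
  by apply/fdisjointP_in => x xl; rewrite in_fsetD xl.
have [R [gR _ _]] := gamma_carry g dX.
exists (Z `|` R); last by rewrite in_fsetU yZ.
rewrite {1}(_ : X = line t.1.1 t.1.2 `|` (X `\` line t.1.1 t.1.2)) //.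
by apply/fsetP => x; rewrite in_fsetU in_fsetD; have := fsubsetP lX x; bool_cases.
Qed.

Lemma separated_exists P : exists2 D, separated D &
  gamma (\bigcup_(t <- D) dpat t) P.
Proof.
have [m] := ubnP #|` P|; elim: m => // m IH in P *; rewrite ltnS => le_m.
have [->|P0] := eqVneq P fset0.
  by exists [::]; [split|rewrite big_nil; apply: gamma_refl].
have [v [n [C [R [h hmax]]]]] := max_core_split P0.
have [n0 lC Ct dCR g] := h.
have cC : (n <= #|` C|)%N by rewrite -{1}(card_line v n) fsubset_leq_card.
have cR : #|` P| = (#|` C| + #|` R|)%N.
  rewrite -(gamma_card g) cardfsU; move: dCR; rewrite /fdisjoint => /eqP->.
  by rewrite cardfs0 subn0.
have [|D sD gD] := IH R; first by rewrite cR in le_m; move: le_m cC n0; lia.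
set X := \bigcup_(t <- D) dpat t in gD.
have fX : filling X = \bigcup_(t <- D) dtri t by apply: filling_separated.
(* A point of the filling is occupied by some [Q] in the orbit of [R], and [Q] is again the rest of
   a maximal splitting. *)
have farX : far (tri v n) (filling X).
  move=> x y xt; rewrite fX => /separated_reach[Q gQ yQ].
  have hQ : core_split P v n C Q.
    by apply: max_core_gamma h => //; apply: gamma_trans gQ; apply: gamma_sym.
  exact: (max_core_far hQ hmax).
have cCt : (#|` C| <= n + (n * (n - 1)) %/ 2)%N.
  by rewrite -(card_tri v) fsubset_leq_card.
pose t := (v, n, (#|` C| - n)%N).
have kt : (t.2 <= (n * (n - 1)) %/ 2)%N by rewrite /= leq_subLR.
have fart u : u \in D -> far (dtri t) (dtri u).
  move=> uD x y xt yu; apply: farX => //; rewrite fX.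
  exact: (fsubsetP (@sub_bigfcup _ D (fun t => dtri t) _ uD)).
case: (sD) => uD posD sepD.
exists (t :: D).
  split=> [|u|u w].
  - rewrite /= uD andbT; apply/negP => tD.
    have /fset0Pn[x xt] : tri v n != fset0.
      by rewrite -cardfs_gt0 card_tri; move: n0; case: (n).
    by have := fart t tD x x xt xt; rewrite eqxx.
  - by rewrite inE => /predU1P[->//|]; apply: posD.
  - rewrite !inE => /predU1P[->|uD'] /predU1P[->|wD]; rewrite ?eqxx //.
    + by move=> _; apply: fart.
    + by move=> _; apply/far_sym/fart.
    + exact: sepD.
rewrite big_cons -/X; apply: gamma_trans (gamma_sym g).
(* First the core is rearranged while [X] rests, then [X] becomes [R] while the core rests;
   separation permits both. *)
apply: (@gamma_trans (C `|` X)).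
  apply: gamma_lift.
    apply: (triangle_connect (line_sub_Ppattern v n _) _ lC Ct).
      exact: Ppattern_sub_tri.
    by rewrite card_translate card_Ppattern // subnKC.
  rewrite filling_Ppattern /=; apply/far_disjoint/far_sym => x y xt yX.
  by apply: farX => //; apply: (fsubsetP (sub_filling X)).
rewrite ![C `|` _]fsetUC; apply: gamma_lift => //.
apply/far_disjoint => x y xC; exact/farX/(fsubsetP Ct).
Qed.

(** * Touching, excess and the final count *)

Lemma card_bigfcup (I : eqType) (s : seq I) (F : I -> pattern) : uniq s ->
  (forall i j, i \in s -> j \in s -> i != j -> [disjoint F i & F j]%fset) ->
  #|` \bigcup_(i <- s) F i| = (\sum_(i <- s) #|` F i|)%N.
Proof.
elim: s => [|i s IH] /=; first by rewrite !big_nil cardfs0.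
move=> /andP[si us] dis; rewrite !big_cons cardfsU IH => //; last first.
  by move=> j k js ks; apply: dis; rewrite inE (js, ks) ?js ?ks orbT.
suff -> : F i `&` \bigcup_(j <- s) F j = fset0 by rewrite cardfs0 subn0.
apply/fsetP => x; rewrite in_fsetI in_fset0; apply/negP.
move=> /andP[xi /bigfcupP[j /andP[js _] xj]].
have /fdisjointP_in : [disjoint F i & F j]%fset.
  apply: dis; rewrite ?inE ?eqxx ?js ?orbT //.
  by apply: contraNneq si => ->.
by apply; eauto.
Qed.

Lemma far_not_touch A B : far (filling A) (filling B) -> ~ touch A B.
Proof.
move=> h; case=> /eqP/fset0Pn[x]; rewrite in_fsetI.
  move=> /andP[xA /neighbourhoodP[y yB xy]]; have := h _ _ xA yB.
  by rewrite neighbours_sym xy andbF.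
move=> /andP[xB /neighbourhoodP[y yA xy]]; have := h _ _ yA xB.
by rewrite xy andbF.
Qed.

(** The constructed triangles decompose the orbit-invariant filling, and such a decomposition is
    unique. *)
Lemma separated_filling_triangles P D : separated D ->
  gamma (\bigcup_(t <- D) dpat t) P ->
  perm_eq (filling_triangles P) [seq t.1 | t <- D].
Proof.
move=> sD g; have [uD posD sepD] := sD.
have inj : {in D &, injective (fun t : point * nat * nat => t.1)}.
  move=> t u tD uD' e; apply/eqP/negPn/negP => ne.
  have [n0 _] := posD _ tD.
  have /fset0Pn[x xt] : dtri t != fset0.
    by rewrite -cardfs_gt0 card_tri; move: n0; case: (t.1.2).
  by have := sepD _ _ tD uD' ne x x xt; rewrite -e => /(_ xt); rewrite eqxx.
have uM : uniq [seq t.1 | t <- D] by rewrite map_inj_in_uniq.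
have -> : filling_triangles P = [fset x in [seq t.1 | t <- D]].
  apply: triangle_decomposition_uniq (filling_trianglesP P) _.
  split=> [t|| t u].
  - by rewrite inE => /mapP[u /posD[u0 _] ->].
  - rewrite (gamma_filling g) filling_separated //.
    apply/fsetP => x; apply/bigfcupP/bigfcupP => -[t].
      rewrite andbT => tD xt; exists t.1 => //; rewrite andbT inE.
      exact: map_f.
    rewrite andbT inE => /mapP[u uD' ->] xt; exists u => //.
    by rewrite uD'.
  - rewrite !inE => /mapP[t' tD ->] /mapP[u' uD' ->] ne.
    have {}ne : t' != u' by apply: contraNneq ne => ->.
    apply/fsetP => x; rewrite in_fsetI in_fset0; apply/negP.
    move=> /andP[/neighbourhoodP[y yt xy] xu].
    by have := sepD _ _ tD uD' ne y x yt xu; rewrite xy andbF.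
apply: uniq_perm => //.
by move=> x; rewrite inE.
Qed.

Theorem theorem3 (P : pattern) (P_nonempty : P != fset0) :
  exists (r : nat) (n k : 'I_r -> nat) (v : 'I_r -> int * int),
    [/\ forall i, (1 <= n i)%N /\ (k i <= (n i * (n i - 1)) %/ 2)%N,
        gamma (\big[fsetU/fset0]_(i < r) translate (v i) (Ppattern (n i) (k i))) P,
        forall i j : 'I_r, i != j ->
          ~ touch (translate (v i) (Ppattern (n i) (k i)))
                  (translate (v j) (Ppattern (n j) (k j))),
        (\sum_(i < r) (n i)%:Z) = #|` P|%:Z - excess P
      & (\sum_(i < r) (k i)%:Z) = excess P].
Proof.
have [D sD g] := separated_exists P; have [uD posD sepD] := sD.
pose t0 : point * nat * nat := (0, 0%N, 0%N).
pose T (i : 'I_(size D)) := nth t0 D i.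
have sumn : \sum_(t <- D) (t.1.2)%:Z = #|` P|%:Z - excess P.
  rewrite /excess opprB addrC subrK.
  by rewrite (perm_big _ (separated_filling_triangles sD g)) big_map.
(* Size is an orbit invariant and each P_{n,k} has n + k points; subtracting the sum of the sides
   leaves the excess. *)
have cardP : #|` P|%:Z = \sum_(t <- D) (t.1.2)%:Z + \sum_(t <- D) (t.2)%:Z.
  rewrite (gamma_card g) card_bigfcup // => [|t u tD uD' ne]; last first.
    apply: fdisjointWl (Ppattern_sub_tri _ _ _) _.
    apply: fdisjointWr (Ppattern_sub_tri _ _ _) _.
    exact/far_disjoint/sepD.
  rewrite -big_split /= -natz natr_sum big_seq [RHS]big_seq.
  apply: eq_bigr => t /posD[_ kt]; rewrite card_translate card_Ppattern //.
  by rewrite natz PoszD.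
have TD i : T i \in D by rewrite mem_nth.
exists (size D), (fun i => (T i).1.2), (fun i => (T i).2), (fun i => (T i).1.1).
split.
- by move=> i; have [] := posD _ (TD i).
- by move: g; rewrite (big_nth t0) big_mkord.
- move=> i j ij; apply: far_not_touch; rewrite !filling_Ppattern.
  by apply: sepD => //; rewrite nth_uniq.
- by rewrite -sumn (big_nth t0) big_mkord.
- transitivity (\sum_(t <- D) (t.2)%:Z); first by rewrite (big_nth t0) big_mkord.
  by move: cardP sumn; lia.
Qed.
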